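(* Let $H$ be a Hopf algebra over a field $\Bbbk$. Then the category of right Hopf partial comodules over $H$ is equivalent to the category whose objects are pairs $(V,N)$ consisting of a $\Bbbk$-vector space $V$ and an $H$-submodule $N$ of $V\otimes H$ such that $(V\otimes\Delta(H))\cap(N\otimes H)=0$ in $V\otimes H\otimes H$, and whose morphisms $(V,N)\to(V',N')$ are given by $\Bbbk$-linear maps $f:V\to V'$ such that $(f\otimes H)(N)\subset N'$.
   Context: $V\otimes H$ is a right $H$-module by multiplication on the right tensorand: $(v\otimes h)\cdot k=v\otimes hk$. $\mathsf{Mod}_H$ denotes right $H$-modules, monoidal with $\otimes=\otimes_\Bbbk$ and diagonal action; $H$ with the regular right module structure is a coalgebra in $\mathsf{Mod}_H$. A right Hopf partial comodule over $H$ is a geometric partial comodule $(M,M\bullet H,\pi_M,\rho_M)$ over $(H,\Delta,\varepsilon)$ in $\mathsf{Mod}_H$, i.e.: $M$ and $M\bullet H$ are right $H$-modules, $\rho_M:M\to M\bullet H$ is $H$-linear, $\pi_M:M\otimes H\to M\bullet H$ is an $H$-linear surjection ($M\otimes H$ with diagonal action), and the following hold. Let $(M\bullet H)\bullet H$, with maps $\rho_M\bullet H:M\bullet H\to(M\bullet H)\bullet H$ and $\pi_{M\bullet H}:(M\bullet H)\otimes H\to(M\bullet H)\bullet H$, be the pushout of $\pi_M$ and $\rho_M\otimes H$; let $M\bullet(H\bullet H)$, with maps $M\bullet\Delta:M\bullet H\to M\bullet(H\bullet H)$ and $\pi_{M,\Delta}:(M\bullet H)\otimes H\to M\bullet(H\bullet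 H)$, be the pushout of $\pi_M$ and $(\pi_M\otimes H)\circ(M\otimes\Delta)$. (GPC1) There is $M\bullet\varepsilon:M\bullet H\to M$ with $(M\bullet\varepsilon)\circ\rho_M=\mathrm{Id}_M$ and $(M\bullet\varepsilon)\circ\pi_M=M\otimes\varepsilon$. (GPC2) There is an isomorphism $\theta:M\bullet(H\bullet H)\to(M\bullet H)\bullet H$ with $\theta\circ\pi_{M,\Delta}=\pi_{M\bullet H}$ and $\theta\circ(M\bullet\Delta)\circ\rho_M=(\rho_M\bullet H)\circ\rho_M$. A morphism of Hopf partial comodules $M\to M'$ is an $H$-linear map $f:M\to M'$ that is a morphism of geometric partial comodules, i.e. there is a (necessarily unique) map $f\bullet H:M\bullet H\to M'\bullet H$ with $(f\bullet H)\circ\rho_M=\rho_{M'}\circ f$ and $(f\bullet H)\circ\pi_M=\pi_{M'}\circ(f\otimes H)$. *)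

(* Defs.v *)
From HB Require Import structures.
From mathcomp Require Import all_boot all_algebra.
From mathcomp Require Import generic_quotient.
From mathcomp Require Import boolp.
From mathcomp.multinomials Require Import freeg.

Set Implicit Arguments.
Unset Strict Implicit.
Unset Printing Implicit Defensive.

Import GRing.Theory.
Local Open Scope ring_scope.
Local Open Scope quotient_scope.

Reserved Notation "V \ox W" (at level 40, left associativity).
Reserved Notation "v *t w" (at level 40, left associativity).

Section Submodules.
Variables (k : fieldType) (U : lmodType k).

Record submod := Submod {
  smem :> U -> Prop;
  smem0 : smem 0;
  smem_lin : forall (a : k) u v, smem u -> smem v -> smem (a *: u + v) }.

Lemma smemD (S : submod) u v : S u -> S v -> S (u + v).
Proof. by move=> Su Sv; rewrite -[u]scale1r; apply: smem_lin. Qed.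

Lemma smemZ (S : submod) a u : S u -> S (a *: u).
Proof. by move=> Su; rewrite -[_ *: _]addr0; apply: smem_lin Su (smem0 S). Qed.

Lemma smemN (S : submod) u : S u -> S (- u).
Proof. by move=> Su; rewrite -scaleN1r; apply: smemZ. Qed.

Lemma span_smem0 (R : U -> Prop) :
  forall S : submod, (forall u, R u -> S u) -> S 0.
Proof. by move=> S _; apply: smem0. Qed.

Lemma span_smem_lin (R : U -> Prop) (a : k) u v :
  (forall S : submod, (forall u, R u -> S u) -> S u) ->
  (forall S : submod, (forall u, R u -> S u) -> S v) ->
  forall S : submod, (forall u, R u -> S u) -> S (a *: u + v).
Proof. by move=> hu hv S RS; apply: smem_lin; [apply: hu | apply: hv]. Qed.

Definition submod_span (R : U -> Prop) : submod :=
  Submod (@span_smem0 R) (@span_smem_lin R).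

End Submodules.

Section LinearMaps.
Variable k : fieldType.

Definition mklin (U V : lmodType k) (f : U -> V) (hf : linear f) :
    {linear U -> V} :=
  HB.pack f (GRing.isLinear.Build k U V *:%R f hf).

Lemma linear_ext (U V : lmodType k) (f g : {linear U -> V}) : f =1 g -> f = g.
Proof.
case: f g => f [[f1] [f2]] [g [[g1] [g2]]] /= /funext fg; subst g.
by rewrite (Prop_irrelevance f1 g1) (Prop_irrelevance f2 g2).
Qed.

End LinearMaps.

Section Quotient.
Variables (k : fieldType) (U : lmodType k) (S : submod U).

Definition quot_rel (x y : U) : bool := `[< S (x - y) >].

Lemma quot_rel_refl : reflexive quot_rel.
Proof. by move=> x; apply/asboolP; rewrite subrr; apply: smem0. Qed.

Lemma quot_rel_sym : symmetric quot_rel.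
Proof.
by move=> x y; apply/asboolP/asboolP => /smemN; rewrite opprB.
Qed.

Lemma quot_rel_trans : transitive quot_rel.
Proof.
move=> y x z /asboolP xy /asboolP yz; apply/asboolP.
by move: (smemD xy yz); rewrite addrA subrK.
Qed.

Canonical quot_equiv :=
  EquivRel quot_rel quot_rel_refl quot_rel_sym quot_rel_trans.

Definition quot : Type := {eq_quot quot_equiv}.
HB.instance Definition _ := Choice.on quot.

Definition qpi (u : U) : quot := \pi_{eq_quot quot_equiv} u.
Definition qrep (x : quot) : U := @repr _ {eq_quot quot_equiv} x.

Lemma qrepK x : qpi (qrep x) = x. Proof. exact: reprK. Qed.

Lemma qpiP u v : qpi u = qpi v <-> S (u - v).
Proof.
split; first by move/eqmodP/asboolP.
by move=> h; apply/eqmodP/asboolP.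
Qed.

Definition quot_add x y := qpi (qrep x + qrep y).
Definition quot_opp x := qpi (- qrep x).
Definition quot_scale (a : k) x := qpi (a *: qrep x).

Lemma qrep_pi u : S (qrep (qpi u) - u).
Proof. by apply/qpiP; rewrite qrepK. Qed.

Lemma quot_addE u v : quot_add (qpi u) (qpi v) = qpi (u + v).
Proof. by apply/qpiP; rewrite opprD addrACA; apply: smemD; apply: qrep_pi. Qed.

Lemma quot_oppE u : quot_opp (qpi u) = qpi (- u).
Proof. by apply/qpiP; rewrite -opprD; apply/smemN/qrep_pi. Qed.

Lemma quot_scaleE a u : quot_scale a (qpi u) = qpi (a *: u).
Proof. by apply/qpiP; rewrite -scalerBr; apply/smemZ/qrep_pi. Qed.

Lemma quotW (P : quot -> Prop) : (forall u, P (qpi u)) -> forall x, P x.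
Proof. by move=> h x; rewrite -[x]qrepK; apply: h. Qed.

Lemma quot_addA : associative quot_add.
Proof.
elim/quotW=> x; elim/quotW=> y; elim/quotW=> z.
by rewrite !quot_addE addrA.
Qed.

Lemma quot_addC : commutative quot_add.
Proof. by elim/quotW=> x; elim/quotW=> y; rewrite !quot_addE addrC. Qed.

Lemma quot_add0 : left_id (qpi 0) quot_add.
Proof. by elim/quotW=> x; rewrite quot_addE add0r. Qed.

Lemma quot_addN : left_inverse (qpi 0) quot_opp quot_add.
Proof. by elim/quotW=> x; rewrite quot_oppE quot_addE addNr. Qed.

HB.instance Definition _ :=
  GRing.isZmodule.Build quot quot_addA quot_addC quot_add0 quot_addN.

Lemma quot_scaleA a b x : quot_scale a (quot_scale b x) = quot_scale (a * b) x.
Proof. by elim/quotW: x => x; rewrite !quot_scaleE scalerA. Qed.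

Lemma quot_scale1 : left_id 1 quot_scale.
Proof. by elim/quotW=> x; rewrite quot_scaleE scale1r. Qed.

Lemma quot_scaleDr : right_distributive quot_scale +%R.
Proof.
move=> a; elim/quotW=> x; elim/quotW=> y.
change (quot_scale a (quot_add (qpi x) (qpi y)) =
  quot_add (quot_scale a (qpi x)) (quot_scale a (qpi y))).
by rewrite !(quot_addE, quot_scaleE) scalerDr.
Qed.

Lemma quot_scaleDl x : {morph quot_scale^~ x : a b / a + b}.
Proof.
elim/quotW: x => x a b.
change (quot_scale (a + b) (qpi x) =
  quot_add (quot_scale a (qpi x)) (quot_scale b (qpi x))).
by rewrite !quot_scaleE quot_addE scalerDl.
Qed.

HB.instance Definition _ := GRing.Zmodule_isLmodule.Build k quot
  quot_scaleA quot_scale1 quot_scaleDr quot_scaleDl.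

Lemma qpi_linear : linear qpi.
Proof.
move=> a u v; rewrite [RHS](_ : _ = quot_add (quot_scale a (qpi u)) (qpi v)) //.
by rewrite quot_scaleE quot_addE.
Qed.
HB.instance Definition _ := GRing.isLinear.Build k U quot *:%R qpi qpi_linear.

Variable V : lmodType k.
Implicit Type f : {linear U -> V}.

(* The map U / S -> V induced by f, for f vanishing on S. *)
Definition qlift f (x : quot) : V := f (qrep x).

Lemma qliftE f u : (forall s, S s -> f s = 0) -> qlift f (qpi u) = f u.
Proof.
by move=> fS; apply/eqP; rewrite -subr_eq0 -raddfB; apply/eqP/fS/qrep_pi.
Qed.

Lemma qlift_linear f : (forall s, S s -> f s = 0) -> linear (qlift f).
Proof.
move=> fS a; elim/quotW=> u; elim/quotW=> v.
by rewrite -linearP !qliftE // linearP.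
Qed.

End Quotient.

(* The tensor product over k: the free module on V * W modulo the relations
   of bilinearity. *)
Section Tensor.
Variable k : fieldType.

Definition bilin (V W U : lmodType k) (b : V -> W -> U) : Prop :=
  (forall w, linear (b^~ w)) /\ (forall v, linear (b v)).

Variables V W : lmodType k.
Local Notation gen v w := (<< (v, w) >> : {freeg (V * W)%type / k}).

Inductive tens_rel : {freeg (V * W)%type / k} -> Prop :=
| TensRelL a v v' w :
    tens_rel (gen (a *: v + v') w - (a *: gen v w + gen v' w))
| TensRelR a v w w' :
    tens_rel (gen v (a *: w + w') - (a *: gen v w + gen v w')).

Definition tens : lmodType k := quot (submod_span tens_rel).

Definition tpure (v : V) (w : W) : tens := qpi (submod_span tens_rel) (gen v w).

Lemma tpure_bilin : bilin tpure.
Proof.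
split=> [w a v v' | v a w w']; rewrite /tpure -linearP; apply/qpiP => S; apply.
- exact: TensRelL.
- exact: TensRelR.
Qed.

Lemma fglift_linear (U : lmodType k) (K : choiceType) (f : K -> U) :
  linear (fglift f : {freeg K / k} -> U).
Proof.
have Hadd := lift_is_additive f.
have H0 : fglift f 0 = 0 by rewrite -[0 in LHS](subrr 0) Hadd subrr.
have HN x : fglift f (- x) = - fglift f x by rewrite -[- x]add0r Hadd H0 sub0r.
have HD x y : fglift f (x + y) = fglift f x + fglift f y.
  by rewrite -[y in LHS]opprK Hadd HN opprK.
have HU (c : k) x : fglift f << c *g x >> = c *: f x by apply: liftU.
move=> a x y; rewrite HD; congr (_ + _).
have Hs (I : eqType) (s : seq I) (F : I -> {freeg K / k}) :
  fglift f (\sum_(i <- s) F i) = \sum_(i <- s) fglift f (F i).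
  by elim: s => [|i s IH]; rewrite ?big_nil // !big_cons HD IH.
rewrite -{2}[x]freeg_sumE [a *: x]/(fgscale a x) !Hs scaler_sumr.
by apply: eq_bigr => z _; rewrite !HU scalerA.
Qed.

Section Lift.
Variables (U : lmodType k) (b : V -> W -> U) (hb : bilin b).

Definition tlift_fg : {linear {freeg (V * W)%type / k} -> U} :=
  mklin (fglift_linear (fun p => b p.1 p.2)).

Lemma tlift_fgE v w : tlift_fg (gen v w) = b v w.
Proof. by rewrite [LHS]liftU scale1r. Qed.

Lemma tlift_rel (x : {freeg (V * W)%type / k}) :
  submod_span tens_rel x -> tlift_fg x = 0.
Proof.
have K0 : tlift_fg 0 = 0 by rewrite linear0.
have KP (a : k) u v : tlift_fg u = 0 -> tlift_fg v = 0 ->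
    tlift_fg (a *: u + v) = 0.
  by move=> u0 v0; rewrite linearP u0 v0 scaler0 addr0.
move=> /(_ (Submod K0 KP)); apply=> _ [a v v' w | a v w w'];
  rewrite -[smem _ _]/(tlift_fg _ = 0) linearB linearP !tlift_fgE.
- by rewrite hb.1 subrr.
- by rewrite hb.2 subrr.
Qed.

(* The linear map V \ox W -> U corresponding to the bilinear map b. *)
Definition tlift : {linear tens -> U} := mklin (qlift_linear tlift_rel).

Lemma tliftE v w : tlift (tpure v w) = b v w.
Proof. by rewrite [LHS](qliftE _ tlift_rel) tlift_fgE. Qed.
End Lift.

Lemma tens_sum (z : tens) :
  exists s : seq (V * W)%type, z = \sum_(p <- s) tpure p.1 p.2.
Proof.
elim/quotW: z => z; rewrite -[z]freeg_sumE.
exists [seq (coeff p z *: p.1, p.2) | p <- dom z].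
rewrite linear_sum [RHS]big_map; apply: eq_bigr => -[v w] _ /=.
have -> : << coeff (v, w) z *g (v, w) >> =
    coeff (v, w) z *: gen v w :> {freeg (V * W)%type / k}.
  apply/eqP/freeg_eqP => y; rewrite coeffZ !coeffU mul1r //.
rewrite linearZ /= -[RHS]/(tpure _ _).
have [hl _] := tpure_bilin; have h0 : tpure 0 w = 0.
  by have := hl w (-1) 0 0; rewrite scaler0 addr0 scaleN1r addNr.
by have := hl w (coeff (v, w) z) v 0; rewrite h0 !addr0.
Qed.

Lemma tens_ext (U : lmodType k) (f g : {linear tens -> U}) :
  (forall v w, f (tpure v w) = g (tpure v w)) -> f =1 g.
Proof.
move=> fg z; have [s ->] := tens_sum z.
by rewrite !linear_sum; apply: eq_bigr => p _; apply: fg.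
Qed.

End Tensor.

Notation "V \ox W" := (tens V W) : type_scope.
Notation "V \ox W" := (tens V W) : ring_scope.
Notation "v *t w" := (tpure v w) : ring_scope.

Section TensorMaps.
Variable k : fieldType.
Implicit Types U V W X Y : lmodType k.

Lemma tens_ind V W (P : V \ox W -> Prop) :
    P 0 -> (forall x y, P x -> P y -> P (x + y)) ->
    (forall v w, P (v *t w)) -> forall z, P z.
Proof.
move=> P0 PD Pp z; have [s ->] := tens_sum z.
by elim: s => [|p s IH]; rewrite ?big_nil // big_cons; apply: PD.
Qed.

Lemma bilinDl V W U (b : V -> W -> U) : bilin b ->
  forall x y w, b (x + y) w = b x w + b y w.
Proof. by move=> [h _] x y w; have := h w 1 x y; rewrite !scale1r. Qed.

Lemma bilinDr V W U (b : V -> W -> U) : bilin b ->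
  forall v x y, b v (x + y) = b v x + b v y.
Proof. by move=> [_ h] v x y; have := h v 1 x y; rewrite !scale1r. Qed.

Lemma bilin0l V W U (b : V -> W -> U) : bilin b -> forall w, b 0 w = 0.
Proof.
by move=> hb w; apply: (addIr (b 0 w)); rewrite -bilinDl // !add0r.
Qed.

Lemma bilin0r V W U (b : V -> W -> U) : bilin b -> forall v, b v 0 = 0.
Proof.
by move=> hb v; apply: (addIr (b v 0)); rewrite -bilinDr // !add0r.
Qed.

Lemma bilinZl V W U (b : V -> W -> U) : bilin b ->
  forall a v w, b (a *: v) w = a *: b v w.
Proof.
move=> hb a v w; have [h _] := hb.
by rewrite -[a *: v]addr0 h (bilin0l hb) addr0.
Qed.

Lemma bilinZr V W U (b : V -> W -> U) : bilin b ->
  forall a v w, b v (a *: w) = a *: b v w.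
Proof.
move=> hb a v w; have [_ h] := hb.
by rewrite -[a *: w]addr0 h (bilin0r hb) addr0.
Qed.

Lemma bilin_comp V W U V' W' (b : V -> W -> U)
    (f : {linear V' -> V}) (g : {linear W' -> W}) :
  bilin b -> bilin (fun v w => b (f v) (g w)).
Proof. by move=> [hl hr]; split=> ? a x y; rewrite linearP (hl, hr). Qed.

(* A map multilinear in two pairs of variables stays bilinear in the first
   pair after lifting to the tensor product in the second one. *)
Lemma bilin_tlift X Y V W U (c : X -> Y -> V -> W -> U)
    (h : forall x y, bilin (c x y)) (z : V \ox W) :
    (forall v w, bilin (fun x y => c x y v w)) ->
  bilin (fun x y => tlift (h x y) z).
Proof.
move=> h'; have [s ->] := tens_sum z; split=> [y a x x' | x a y y'];
  rewrite !linear_sum -big_split; apply: eq_bigr => -[v w] _;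
  by rewrite !tliftE ((h' v w).1, (h' v w).2).
Qed.

Lemma linear_tlift X V W U (c : X -> V -> W -> U)
    (h : forall x, bilin (c x)) (z : V \ox W) :
    (forall v w, linear (fun x => c x v w)) ->
  linear (fun x => tlift (h x) z).
Proof.
move=> h' a x x'; have [s ->] := tens_sum z.
rewrite !linear_sum -big_split; apply: eq_bigr => -[v w] _.
by rewrite !tliftE h'.
Qed.

Section Map.
Variables (V V' W W' : lmodType k).
Variables (f : {linear V -> V'}) (g : {linear W -> W'}).

Definition tmap : {linear V \ox W -> V' \ox W'} :=
  tlift (bilin_comp f g (tpure_bilin V' W')).

Lemma tmapE v w : tmap (v *t w) = f v *t g w.
Proof. exact: tliftE. Qed.
End Map.

Lemma tmap_id V W : tmap (idfun : {linear V -> V}) (idfun : {linear W -> W}) =1 id.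
Proof. by apply: (@tens_ext _ _ _ _ _ idfun) => v w; rewrite tmapE. Qed.

Lemma tmap_comp V V' V'' W W' W'' (f : {linear V -> V'}) (f' : {linear V' -> V''})
    (g : {linear W -> W'}) (g' : {linear W' -> W''}) z :
  tmap f' g' (tmap f g z) =
  tmap (f' \o f : {linear V -> V''}) (g' \o g : {linear W -> W''}) z.
Proof.
move: z; apply: (@tens_ext _ _ _ _ (tmap f' g' \o tmap f g)) => v w.
by rewrite [LHS](_ : _ = tmap f' g' (tmap f g (v *t w))) // !tmapE.
Qed.

Section Assoc.
Variables U V W : lmodType k.

Lemma assoc_bilin1 (w : W) :
  bilin (fun (u : U) (v : V) => u *t (v *t w)).
Proof.
have h1 := tpure_bilin U (V \ox W); have h2 := tpure_bilin V W.
by split=> ? a x y; rewrite ?h2.1 (h1.1, h1.2).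
Qed.

Lemma assoc_bilin :
  bilin (fun (x : U \ox V) (w : W) => tlift (assoc_bilin1 w) x).
Proof.
split=> [w | x]; first exact: linearP.
apply: linear_tlift => u v a w w'.
by rewrite (tpure_bilin V W).2 (tpure_bilin U (V \ox W)).2.
Qed.

Definition assoc : {linear (U \ox V) \ox W -> U \ox (V \ox W)} :=
  tlift assoc_bilin.

Lemma assocE u v w : assoc ((u *t v) *t w) = u *t (v *t w).
Proof. by rewrite /assoc !tliftE. Qed.

Lemma unassoc_bilin1 (u : U) :
  bilin (fun (v : V) (w : W) => (u *t v) *t w).
Proof.
have h1 := tpure_bilin (U \ox V) W; have h2 := tpure_bilin U V.
by split=> ? a x y; rewrite ?h2.2 (h1.1, h1.2).
Qed.

Lemma unassoc_bilin :
  bilin (fun (u : U) (x : V \ox W) => tlift (unassoc_bilin1 u) x).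
Proof.
split=> [x | u]; last exact: linearP.
apply: linear_tlift => v w a u u'.
by rewrite (tpure_bilin U V).1 (tpure_bilin (U \ox V) W).1.
Qed.

Definition unassoc : {linear U \ox (V \ox W) -> (U \ox V) \ox W} :=
  tlift unassoc_bilin.

Lemma unassocE u v w : unassoc (u *t (v *t w)) = (u *t v) *t w.
Proof. by rewrite /unassoc !tliftE. Qed.

Lemma assocK : cancel assoc unassoc.
Proof.
elim/tens_ind => [|x y|x w]; rewrite ?linear0 // ?linearD ?linearD.
- by move=> -> ->.
elim/tens_ind: x => [|x y hx hy|u v]; last by rewrite assocE unassocE.
- by rewrite (bilin0l (tpure_bilin _ _)) !linear0.
by rewrite (bilinDl (tpure_bilin _ _)) !linearD hx hy.
Qed.

Lemma unassocK : cancel unassoc assoc.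
Proof.
elim/tens_ind => [|x y|u x]; rewrite ?linear0 // ?linearD ?linearD.
- by move=> -> ->.
elim/tens_ind: x => [|x y hx hy|v w]; last by rewrite unassocE assocE.
- by rewrite (bilin0r (tpure_bilin _ _)) !linear0.
by rewrite (bilinDr (tpure_bilin _ _)) !linearD hx hy.
Qed.
End Assoc.

(* The subspace A \ox B of V \ox W, for subspaces A of V and B of W. *)
Definition tsub V W (A : V -> Prop) (B : W -> Prop) (z : V \ox W) : Prop :=
  exists2 s : seq (V * W)%type,
    (forall p, p \in s -> A p.1 /\ B p.2) & z = \sum_(p <- s) p.1 *t p.2.

End TensorMaps.

Arguments assoc {k U V W}.
Arguments unassoc {k U V W}.
Arguments assocK {k U V W}.
Arguments unassocK {k U V W}.

Section RightModules.
Variables (k : fieldType) (A : algType k).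

Record rmod := RMod {
  rcar :> lmodType k;
  ract : rcar -> A -> rcar;
  ract_bilin : bilin ract;
  ract1 : forall m, ract m 1 = m;
  ractM : forall m a b, ract m (a * b) = ract (ract m a) b }.

Lemma ractN (M : rmod) (m : M) a : ract (- m) a = - ract m a.
Proof. by rewrite -scaleN1r (bilinZl (ract_bilin M)) scaleN1r. Qed.

Lemma ractD (M : rmod) (m n : M) a : ract (m + n) a = ract m a + ract n a.
Proof. exact: (bilinDl (ract_bilin M)). Qed.

Record rhom (M N : rmod) := RHom {
  rfun :> {linear M -> N};
  rfunJ : forall m a, rfun (ract m a) = ract (rfun m) a }.

Lemma rhom_ext (M N : rmod) (f g : rhom M N) : f =1 g -> f = g.
Proof.
case: f g => f hf [g hg] /= /(@linear_ext _ _ _ f g) fg; subst g.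
by rewrite (Prop_irrelevance hf hg).
Qed.

Lemma rid_subproof (M : rmod) m a :
  (idfun : {linear M -> M}) (ract m a) = ract (idfun m) a.
Proof. by []. Qed.
Definition rid (M : rmod) : rhom M M := RHom (@rid_subproof M).

Lemma rcomp_subproof (M N P : rmod) (g : rhom N P) (f : rhom M N) m a :
  (g \o f : {linear M -> P}) (ract m a) = ract ((g \o f) m) a.
Proof. by rewrite /= !rfunJ. Qed.
Definition rcomp (M N P : rmod) (g : rhom N P) (f : rhom M N) : rhom M P :=
  RHom (rcomp_subproof g f).

Lemma reg_bilin : bilin (fun x a : A => x * a).
Proof.
by split=> [a c x y | x c a b]; rewrite (mulrDl, mulrDr) -(scalerAl, scalerAr).
Qed.

Definition rreg : rmod := RMod reg_bilin (@mulr1 A) (@mulrA A).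

Record rsubmod (M : rmod) := RSubmod {
  rsub :> submod M;
  rsubJ : forall m a, rsub m -> rsub (ract m a) }.

Section Quot.
Variables (M : rmod) (S : rsubmod M).

Definition rquot_act (x : quot S) (a : A) : quot S := qpi S (ract (qrep x) a).

Lemma rquot_actE m a : rquot_act (qpi S m) a = qpi S (ract m a).
Proof.
apply/qpiP; rewrite -ractN -ractD.
exact/rsubJ/qrep_pi.
Qed.

Lemma rquot_bilin : bilin rquot_act.
Proof.
split=> [a c | + c a b]; elim/quotW=> x; last first.
  by rewrite !rquot_actE (ract_bilin M).2 linearP.
by elim/quotW=> y; rewrite -linearP !rquot_actE (ract_bilin M).1 linearP.
Qed.

Lemma rquot_act1 x : rquot_act x 1 = x.
Proof. by elim/quotW: x => x; rewrite rquot_actE ract1. Qed.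

Lemma rquot_actM x a b : rquot_act x (a * b) = rquot_act (rquot_act x a) b.
Proof. by elim/quotW: x => x; rewrite !rquot_actE ractM. Qed.

Definition rquot : rmod := RMod rquot_bilin rquot_act1 rquot_actM.

Lemma rqpiJ m a : qpi S (ract m a) = @ract rquot (qpi S m) a.
Proof. by rewrite -rquot_actE. Qed.

Definition rqpi : rhom M rquot := @RHom M rquot (qpi S) rqpiJ.
End Quot.

Section Prod.
Variables M N : rmod.

Definition rprod_act (x : M * N) (a : A) := (ract x.1 a, ract x.2 a).

Lemma rprod_bilin : @bilin k (M * N)%type A (M * N)%type rprod_act.
Proof.
have hM := ract_bilin M; have hN := ract_bilin N.
split=> [a c x y | x c a b]; rewrite /rprod_act.
- by rewrite /= hM.1 hN.1.
- by rewrite /= hM.2 hN.2.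
Qed.

Lemma rprod_act1 x : rprod_act x 1 = x.
Proof. by rewrite /rprod_act !ract1; case: x. Qed.

Lemma rprod_actM x a b : rprod_act x (a * b) = rprod_act (rprod_act x a) b.
Proof. by rewrite /rprod_act !ractM. Qed.

Definition rprod : rmod := RMod rprod_bilin rprod_act1 rprod_actM.
End Prod.

(* The pushout of f : B -> C and g : B -> D in the category of right
   A-modules: the quotient of C * D by the submodule of all (f b, - g b). *)
Section Pushout.
Variables (B C D : rmod) (f : rhom B C) (g : rhom B D).

Definition po_set (x : rprod C D) : Prop := exists b, x = (f b, - g b).

Lemma po_set0 : po_set 0.
Proof. by exists 0; rewrite !linear0. Qed.

Lemma po_set_lin (c : k) x y : po_set x -> po_set y -> po_set (c *: x + y).
Proof.
move=> [b ->] [b' ->]; exists (c *: b + b').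
by rewrite !linearP.
Qed.

Lemma po_setJ x a : po_set x -> po_set (ract x a).
Proof.
move=> [b ->]; exists (ract b a); rewrite !rfunJ.
by rewrite -ractN.
Qed.

Definition pushout : rmod :=
  rquot (@RSubmod _ (Submod po_set0 po_set_lin) po_setJ).

Lemma po_inl_linear :
  linear (fun c : C => qpi (Submod po_set0 po_set_lin) (c, 0)).
Proof.
move=> a x y; rewrite -linearP; congr (qpi _ _).
by congr pair; rewrite /= scaler0 addr0.
Qed.

Lemma po_inr_linear :
  linear (fun d : D => qpi (Submod po_set0 po_set_lin) (0, d)).
Proof.
move=> a x y; rewrite -linearP; congr (qpi _ _).
by congr pair; rewrite /= scaler0 addr0.
Qed.

Lemma po_inlJ m a :
  mklin po_inl_linear (ract m a) = @ract pushout (mklin po_inl_linear m) a.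
Proof.
by rewrite /= rquot_actE /= /rprod_act /= (bilin0l (ract_bilin D)).
Qed.

Lemma po_inrJ m a :
  mklin po_inr_linear (ract m a) = @ract pushout (mklin po_inr_linear m) a.
Proof.
by rewrite /= rquot_actE /= /rprod_act /= (bilin0l (ract_bilin C)).
Qed.

Definition po_inl : rhom C pushout := @RHom C pushout _ po_inlJ.
Definition po_inr : rhom D pushout := @RHom D pushout _ po_inrJ.

Lemma pushout_comm b : po_inl (f b) = po_inr (g b).
Proof.
apply/qpiP; exists b; congr pair; rewrite /= ?subr0 ?sub0r //.
Qed.

Lemma po_copair_linear (X : rmod) (u : rhom C X) (v : rhom D X) :
  linear (fun x : C * D => u x.1 + v x.2).
Proof. by move=> a x y; rewrite /= !linearP scalerDr addrACA. Qed.

Lemma pushout_universal (X : rmod) (u : rhom C X) (v : rhom D X) :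
  (forall b, u (f b) = v (g b)) ->
  exists! w : rhom pushout X,
    (forall c, w (po_inl c) = u c) /\ (forall d, w (po_inr d) = v d).
Proof.
move=> uv; pose S := Submod po_set0 po_set_lin.
pose F := mklin (po_copair_linear u v).
have FS s : S s -> F s = 0.
  by move=> [b ->]; rewrite /= linearN uv subrr.
have FJ m a : mklin (qlift_linear FS) (@ract pushout m a) =
    ract (mklin (qlift_linear FS) m) a.
  elim/quotW: m => m; rewrite [@ract pushout _ _]rquot_actE.
  rewrite [LHS](qliftE _ FS) [in RHS](qliftE _ FS : mklin _ _ = _).
  by rewrite /F /= !rfunJ ractD.
exists (@RHom pushout X _ FJ); split; first split=> x.
- by rewrite [LHS](qliftE _ FS) /= linear0 addr0.
- by rewrite [LHS](qliftE _ FS) /= linear0 add0r.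
move=> w [wl wr]; apply: rhom_ext; elim/quotW=> -[c d].
rewrite [LHS](qliftE _ FS) /= -wl -wr -linearD; congr (w _).
by rewrite /= -linearD; congr (qpi _ _); congr pair; rewrite /= ?addr0 ?add0r.
Qed.
End Pushout.

(* (m \ox n) (a \ox b) = m a \ox n b *)
Section Act2.
Variables M N : rmod.

Lemma act2_bilin1 (m : M) (n : N) :
  bilin (fun a b : A => ract m a *t ract n b).
Proof.
have hM := ract_bilin M; have hN := ract_bilin N.
have h := tpure_bilin M N.
by split=> ? c x y; rewrite ?hM.2 ?hN.2 (h.1, h.2).
Qed.

Lemma act2_bilin2 (u : A \ox A) :
  bilin (fun (m : M) (n : N) => tlift (act2_bilin1 m n) u).
Proof.
apply: bilin_tlift => a b.
have hM := ract_bilin M; have hN := ract_bilin N.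
have h := tpure_bilin M N.
by split=> ? c x y; rewrite ?hM.1 ?hN.1 (h.1, h.2).
Qed.

Definition act2 (z : M \ox N) (u : A \ox A) : M \ox N :=
  tlift (act2_bilin2 u) z.

Lemma act2E m n a b : act2 (m *t n) (a *t b) = ract m a *t ract n b.
Proof. by rewrite /act2 !tliftE. Qed.

Lemma act2_bilin : bilin act2.
Proof.
split=> [u | z]; first exact: linearP.
by apply: linear_tlift => m n; apply: linearP.
Qed.
End Act2.

End RightModules.

Section Hopf.
Variable k : fieldType.

Lemma scale_bilin (V W : lmodType k) (f : {linear V -> k^o}) :
  bilin (fun (v : V) (w : W) => f v *: w).
Proof.
split=> ? a x y; rewrite linearP /=; first by rewrite scalerDl scalerA.
by rewrite !scalerA mulrC.
Qed.

Lemma rscale_bilin (V W : lmodType k) (f : {linear W -> k^o}) :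
  bilin (fun (v : V) (w : W) => f w *: v).
Proof. by have [h1 h2] := scale_bilin V f; split. Qed.

(* The linear maps f \ox id and id \ox f, for a linear form f, with k \ox W and
   V \ox k identified with W and V. *)
Definition form_left (V W : lmodType k) (f : {linear V -> k^o}) :
  {linear V \ox W -> W} := tlift (scale_bilin W f).
Definition form_right (V W : lmodType k) (f : {linear W -> k^o}) :
  {linear V \ox W -> V} := tlift (rscale_bilin V f).

(* The product of the tensor product algebra: (a \ox b) (c \ox d) = a c \ox b d. *)
Definition tmul (A : algType k) (x y : A \ox A) : A \ox A :=
  @act2 k A (rreg A) (rreg A) x y.

Lemma tmulE (A : algType k) (a b c d : A) :
  tmul (a *t b) (c *t d) = (a * c) *t (b * d).
Proof. exact: (@act2E k A (rreg A) (rreg A)). Qed.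

Definition mulmap (A : algType k) : {linear A \ox A -> A} := tlift (reg_bilin A).

Arguments form_left {V W}.
Arguments form_right {V W}.
Arguments mulmap {A}.

Record hopfAlgebra := HopfAlgebra {
  hcar :> algType k;
  Delta : {linear hcar -> hcar \ox hcar};
  eps : {linear hcar -> k^o};
  antipode : {linear hcar -> hcar};
  Delta_coassoc : forall h,
    assoc (tmap Delta idfun (Delta h)) = tmap idfun Delta (Delta h);
  Delta_counitl : forall h, form_left eps (Delta h) = h;
  Delta_counitr : forall h, form_right eps (Delta h) = h;
  Delta1 : Delta 1 = 1 *t 1;
  DeltaM : forall g h, Delta (g * h) = tmul (Delta g) (Delta h);
  eps1 : eps 1 = 1;
  epsM : forall g h, eps (g * h) = eps g * eps h;
  antipodel : forall h, mulmap (tmap antipode idfun (Delta h)) = eps h *: 1;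
  antipoder : forall h, mulmap (tmap idfun antipode (Delta h)) = eps h *: 1 }.

Variable H : hopfAlgebra.

Section Act2Theory.
Variables M N : rmod H.
Implicit Types (z : M \ox N) (u v : H \ox H).

Lemma act2_1 z : act2 z (1 *t 1) = z.
Proof.
elim/tens_ind: z => [|x y hx hy|m n]; last by rewrite act2E !ract1.
- exact: bilin0l (act2_bilin M N) _.
- by rewrite (bilinDl (act2_bilin M N)) hx hy.
Qed.

Lemma act2M z u v : act2 z (tmul u v) = act2 (act2 z u) v.
Proof.
have b1 := act2_bilin M N; have b2 := act2_bilin (rreg H) (rreg H).
rewrite /tmul; elim/tens_ind: z => [|x y hx hy|m n].
- by rewrite !(bilin0l b1).
- by rewrite !(bilinDl b1) hx hy.
elim/tens_ind: u => [|x y hx hy|a b].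
- by rewrite (bilin0l b2) !(bilin0r b1) (bilin0l b1).
- by rewrite (bilinDl b2) !(bilinDr b1) (bilinDl b1) hx hy.
elim/tens_ind: v => [|x y hx hy|c d].
- by rewrite (bilin0r b2) !(bilin0r b1).
- by rewrite (bilinDr b2) !(bilinDr b1) hx hy.
by rewrite !act2E !ractM.
Qed.
End Act2Theory.

(* M \ox N with the diagonal action. *)
Section Diag.
Variables M N : rmod H.

Definition diag_act (z : M \ox N) (h : H) : M \ox N := act2 z (Delta H h).

Lemma diag_bilin : bilin diag_act.
Proof. exact: bilin_comp idfun (Delta H) (act2_bilin M N). Qed.

Lemma diag_act1 z : diag_act z 1 = z.
Proof. by rewrite /diag_act Delta1 act2_1. Qed.

Lemma diag_actM z g h : diag_act z (g * h) = diag_act (diag_act z g) h.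
Proof. by rewrite /diag_act DeltaM act2M. Qed.

Definition rtens : rmod H := RMod diag_bilin diag_act1 diag_actM.
End Diag.

Lemma tmap_act2 (M M' N N' : rmod H) (f : rhom M M') (g : rhom N N') z u :
  tmap f g (act2 z u) = act2 (tmap f g z) u.
Proof.
have b1 := act2_bilin M N; have b2 := act2_bilin M' N'.
elim/tens_ind: z => [|x y hx hy|m n].
- by rewrite (bilin0l b1) !linear0 (bilin0l b2).
- by rewrite (bilinDl b1) !linearD (bilinDl b2) hx hy.
elim/tens_ind: u => [|x y hx hy|a b].
- by rewrite (bilin0r b1) !linear0 (bilin0r b2).
- by rewrite (bilinDr b1) linearD (bilinDr b2) hx hy.
by rewrite !(act2E, tmapE) !rfunJ.
Qed.

Lemma rtmapJ (M M' N N' : rmod H) (f : rhom M M') (g : rhom N N') z h :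
  tmap f g (@ract _ _ (rtens M N) z h) =
  @ract _ _ (rtens M' N') (tmap f g z) h.
Proof. exact: tmap_act2. Qed.

Definition rtmap (M M' N N' : rmod H) (f : rhom M M') (g : rhom N N') :
  rhom (rtens M N) (rtens M' N') :=
  @RHom _ _ (rtens M N) (rtens M' N') (tmap f g) (rtmapJ f g).

Lemma rtmap_id (M N : rmod H) : rtmap (rid M) (rid N) =1 id.
Proof. exact: tmap_id. Qed.

Lemma rtmap_comp (M M' M'' N N' N'' : rmod H) (f : rhom M M')
    (f' : rhom M' M'') (g : rhom N N') (g' : rhom N' N'') z :
  rtmap f' g' (rtmap f g z) = rtmap (rcomp f' f) (rcomp g' g) z.
Proof. exact: tmap_comp. Qed.

Section Unassoc.
Variables M N P : rmod H.

Lemma act2_diag_bilin (x : M \ox N) (p : P) :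
  bilin (fun (u : H \ox H) (c : H) => act2 x u *t ract p c).
Proof.
have h1 := act2_bilin M N; have h2 := ract_bilin P.
have h3 := tpure_bilin (M \ox N) P.
by split=> ? a y y'; rewrite ?h1.2 ?h2.2 (h3.1, h3.2).
Qed.

Lemma unassocJ z h :
  unassoc (@ract _ _ (rtens M (rtens N P)) z h) =
  @ract _ _ (rtens (rtens M N) P) (unassoc z) h.
Proof.
rewrite -[LHS]/(unassoc (@act2 _ _ M (rtens N P) z (Delta H h))).
rewrite -[RHS]/(@act2 _ _ (rtens M N) P (unassoc z) (Delta H h)).
have b1 := act2_bilin M (rtens N P); have b2 := act2_bilin (rtens M N) P.
have b3 := tpure_bilin M (N \ox P).
elim/tens_ind: z => [|x y hx hy|m y].
- by rewrite (bilin0l b1) !linear0 (bilin0l b2).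
- by rewrite (bilinDl b1) !linearD (bilinDl b2) hx hy.
elim/tens_ind: y => [|x y hx hy|n p].
- by rewrite (bilin0r b3) (bilin0l b1) !linear0 (bilin0l b2).
- by rewrite (bilinDr b3) (bilinDl b1) !linearD (bilinDl b2) hx hy.
rewrite unassocE; pose G := tlift (act2_diag_bilin (m *t n) p).
have -> : @act2 _ _ (rtens M N) P ((m *t n) *t p) (Delta H h) =
    G (tmap (Delta H) idfun (Delta H h)).
  elim/tens_ind: (Delta H h) => [|x y hx hy|a b].
  - by rewrite (bilin0r b2) !linear0.
  - by rewrite (bilinDr b2) !linearD hx hy.
  by rewrite act2E tmapE /G tliftE.
have -> : tmap (Delta H) idfun (Delta H h) =
    unassoc (tmap idfun (Delta H) (Delta H h)).
  exact: canRL assocK (Delta_coassoc h).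
elim/tens_ind: (Delta H h) => [|x y hx hy|a u].
- by rewrite (bilin0r b1) !linear0.
- by rewrite (bilinDr b1) !linearD hx hy.
rewrite act2E tmapE -[@ract _ _ (rtens N P) _ u]/(act2 (n *t p) (Delta H u)).
elim/tens_ind: (Delta H u) => [|x y hx hy|b c].
- by rewrite (bilin0r (act2_bilin N P)) (bilin0r b3)
    (bilin0r (tpure_bilin _ _)) !linear0.
- by rewrite (bilinDr (act2_bilin N P)) (bilinDr b3)
    (bilinDr (tpure_bilin _ _)) !linearD hx hy.
by rewrite act2E !unassocE /G tliftE act2E.
Qed.

Definition runassoc : rhom (rtens M (rtens N P)) (rtens (rtens M N) P) :=
  @RHom _ _ (rtens M (rtens N P)) (rtens (rtens M N) P)
    unassoc unassocJ.
End Unassoc.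

Definition rH : rmod H := rreg H.

Lemma DeltaJ (g h : H) :
  Delta H (@ract _ _ rH g h) = @ract _ _ (rtens rH rH) (Delta H g) h.
Proof. exact: DeltaM. Qed.

Definition rDelta : rhom rH (rtens rH rH) :=
  @RHom _ _ rH (rtens rH rH) (Delta H) DeltaJ.

(* M \ox Delta : M \ox H -> M \ox H \ox H *)
Definition tDelta (M : rmod H) : rhom (rtens M rH) (rtens (rtens M rH) rH) :=
  rcomp (runassoc M rH rH) (rtmap (rid M) rDelta).

Section PartialComodules.
Variables (M MH : rmod H) (pi : rhom (rtens M rH) MH) (rho : rhom M MH).

(* (M bullet H) bullet H *)
Definition bullet_left : rmod H := pushout pi (rtmap rho (rid rH)).
Definition rho_bullet : rhom MH bullet_left := po_inl pi (rtmap rho (rid rH)).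
Definition pi_bullet : rhom (rtens MH rH) bullet_left :=
  po_inr pi (rtmap rho (rid rH)).

(* M bullet (H bullet H) *)
Definition bullet_right : rmod H :=
  pushout pi (rcomp (rtmap pi (rid rH)) (tDelta M)).
Definition bullet_Delta : rhom MH bullet_right :=
  po_inl pi (rcomp (rtmap pi (rid rH)) (tDelta M)).
Definition pi_Delta : rhom (rtens MH rH) bullet_right :=
  po_inr pi (rcomp (rtmap pi (rid rH)) (tDelta M)).

Definition GPC1 : Prop :=
  exists e : rhom MH M,
    (forall m, e (rho m) = m) /\
    (forall z, e (pi z) = form_right (eps H) z).

Definition GPC2 : Prop :=
  exists theta : rhom bullet_right bullet_left,
    [/\ bijective theta,
        forall z, theta (pi_Delta z) = pi_bullet z
      & forall m, theta (bullet_Delta (rho m)) = rho_bullet (rho m)].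
End PartialComodules.

Record hopfPartialComodule := HopfPartialComodule {
  pc_car :> rmod H;
  pc_bullet : rmod H;
  pc_pi : rhom (rtens pc_car rH) pc_bullet;
  pc_rho : rhom pc_car pc_bullet;
  pc_pi_surj : forall y, exists z, pc_pi z = y;
  pc_gpc1 : GPC1 pc_pi pc_rho;
  pc_gpc2 : GPC2 pc_pi pc_rho }.

Definition is_pc_morphism (M M' : hopfPartialComodule) (f : rhom M M') : Prop :=
  exists fH : rhom (pc_bullet M) (pc_bullet M'),
    (forall m, fH (pc_rho M m) = pc_rho M' (f m)) /\
    (forall z, fH (pc_pi M z) = pc_pi M' (rtmap f (rid rH) z)).

Definition pc_hom (M M' : hopfPartialComodule) : Type :=
  {f : rhom M M' | is_pc_morphism f}.

Lemma pc_id_subproof (M : hopfPartialComodule) :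
  is_pc_morphism (rid M).
Proof. by exists (rid _); split=> // z; rewrite rtmap_id. Qed.
Definition pc_id M : pc_hom M M := exist _ (rid M) (pc_id_subproof M).

Lemma pc_comp_subproof (M M' M'' : hopfPartialComodule)
    (g : pc_hom M' M'') (f : pc_hom M M') :
  is_pc_morphism (rcomp (sval g) (sval f)).
Proof.
case: f g => f [fH [f1 f2]] [g [gH [g1 g2]]].
exists (rcomp gH fH); split=> [m | z].
  by rewrite -[LHS]/(gH (fH _)) f1 g1.
rewrite -[LHS]/(gH (fH _)) f2 g2 rtmap_comp.
by congr (pc_pi _ (rtmap _ _ z)); apply: rhom_ext.
Qed.
Definition pc_comp M M' M'' (g : pc_hom M' M'') (f : pc_hom M M') :
  pc_hom M M'' := exist _ _ (pc_comp_subproof g f).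

(* V \ox H with H acting by multiplication on the right tensorand. *)
Section Free.
Variable V : lmodType k.

Lemma free_act_linear (h : H) : linear (fun g : H => g * h).
Proof. exact: (reg_bilin H).1. Qed.

Definition free_act (z : V \ox H) (h : H) : V \ox H :=
  tmap idfun (mklin (free_act_linear h)) z.

Lemma free_actE v g h : free_act (v *t g) h = v *t (g * h).
Proof. exact: tmapE. Qed.

Lemma free_bilin : bilin free_act.
Proof.
split=> [h | z]; first exact: linearP.
apply: (linear_tlift (U := V \ox H)) => v g a h h'.
by rewrite /= mulrDr -scalerAr (tpure_bilin V H).2.
Qed.

Lemma free_act1 z : free_act z 1 = z.
Proof.
elim/tens_ind: z => [|x y hx hy|v g]; last by rewrite free_actE mulr1.
- exact: linear0.
- by rewrite (bilinDl free_bilin) hx hy.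
Qed.

Lemma free_actM z g h : free_act z (g * h) = free_act (free_act z g) h.
Proof.
elim/tens_ind: z => [|x y hx hy|v c]; last by rewrite !free_actE mulrA.
- by rewrite !(bilin0l free_bilin).
- by rewrite !(bilinDl free_bilin) hx hy.
Qed.

Definition rfree : rmod H := RMod free_bilin free_act1 free_actM.
End Free.

(* V \ox Delta(H) and N \ox H, as subspaces of V \ox H \ox H. *)
Definition V_DeltaH (V : lmodType k) (z : (V \ox H) \ox H) : Prop :=
  tsub (fun _ : V => True) (fun u : H \ox H => exists h, u = Delta H h)
    (assoc z).
Definition N_H (V : lmodType k) (N : V \ox H -> Prop) (z : (V \ox H) \ox H) :
    Prop :=
  tsub N (fun _ : H => True) z.

Record hopfPair := HopfPair {
  hp_V : lmodType k;
  hp_N : rsubmod (rfree hp_V);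
  hp_cap : forall z, V_DeltaH z -> N_H hp_N z -> z = 0 }.

Definition is_hp_morphism (P P' : hopfPair) (f : {linear hp_V P -> hp_V P'}) :
    Prop :=
  forall z, hp_N P z -> hp_N P' (tmap f (idfun : {linear H -> H}) z).

Definition hp_hom (P P' : hopfPair) : Type :=
  {f : {linear hp_V P -> hp_V P'} | is_hp_morphism f}.

Lemma hp_id_subproof (P : hopfPair) :
  is_hp_morphism (idfun : {linear hp_V P -> hp_V P}).
Proof. by move=> z Nz; rewrite tmap_id. Qed.
Definition hp_id P : hp_hom P P := exist _ _ (@hp_id_subproof P).

Lemma hp_comp_subproof (P P' P'' : hopfPair)
    (g : hp_hom P' P'') (f : hp_hom P P') :
  is_hp_morphism (sval g \o sval f : {linear hp_V P -> hp_V P''}).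
Proof.
case: f g => f hf [g hg] z /hf /hg; rewrite tmap_comp.
by congr (hp_N _ (tmap _ _ z)); apply: linear_ext.
Qed.
Definition hp_comp P P' P'' (g : hp_hom P' P'') (f : hp_hom P P') :
  hp_hom P P'' := exist _ _ (hp_comp_subproof g f).

End Hopf.

Record category := Category {
  obj :> Type;
  hom : obj -> obj -> Type;
  cidm : forall X, hom X X;
  ccomp : forall X Y Z, hom Y Z -> hom X Y -> hom X Z;
  ccomp1l : forall X Y (f : hom X Y), ccomp (cidm Y) f = f;
  ccomp1r : forall X Y (f : hom X Y), ccomp f (cidm X) = f;
  ccompA : forall X Y Z T (h : hom Z T) (g : hom Y Z) (f : hom X Y),
    ccomp h (ccomp g f) = ccomp (ccomp h g) f }.

Record functor (C D : category) := Functor {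
  fobj :> C -> D;
  fmap : forall X Y, hom X Y -> hom (fobj X) (fobj Y);
  fmap_id : forall X, fmap (cidm X) = cidm (fobj X);
  fmap_comp : forall X Y Z (g : hom Y Z) (f : hom X Y),
    fmap (ccomp g f) = ccomp (fmap g) (fmap f) }.

Definition functor_id (C : category) : functor C C :=
  @Functor C C id (fun _ _ f => f) (fun _ => erefl) (fun _ _ _ _ _ => erefl).

Section FunctorComp.
Variables (C D E : category) (G : functor D E) (F : functor C D).

Lemma functor_comp_id X : fmap G (fmap F (cidm X)) = cidm (G (F X)).
Proof. by rewrite !fmap_id. Qed.

Lemma functor_comp_comp X Y Z (g : hom Y Z) (f : hom X Y) :
  fmap G (fmap F (ccomp g f)) =
  ccomp (fmap G (fmap F g)) (fmap G (fmap F f)).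
Proof. by rewrite !fmap_comp. Qed.

Definition functor_comp : functor C E :=
  @Functor C E (fun X => G (F X)) (fun _ _ f => fmap G (fmap F f))
    functor_comp_id functor_comp_comp.
End FunctorComp.

Definition is_iso (C : category) (X Y : C) (f : hom X Y) : Prop :=
  exists g : hom Y X, ccomp g f = cidm X /\ ccomp f g = cidm Y.

Definition nat_isomorphic (C D : category) (F G : functor C D) : Prop :=
  exists a : forall X, hom (F X) (G X),
    (forall X, is_iso (a X)) /\
    (forall X Y (f : hom X Y),
       ccomp (a Y) (fmap F f) = ccomp (fmap G f) (a X)).

Definition cat_equivalent (C D : category) : Prop :=
  exists (F : functor C D) (G : functor D C),
    nat_isomorphic (functor_comp G F) (functor_id C) /\
    nat_isomorphic (functor_comp F G) (functor_id D).

Section Categories.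
Variables (k : fieldType) (H : hopfAlgebra k).

Lemma pc_hom_ext (M M' : hopfPartialComodule H) (f g : pc_hom M M') :
  sval f =1 sval g -> f = g.
Proof.
by case: f g => f hf [g hg] /= /rhom_ext fg; apply: eq_exist.
Qed.

Lemma pc_comp1l (M M' : hopfPartialComodule H) (f : pc_hom M M') :
  pc_comp (pc_id M') f = f.
Proof. exact: pc_hom_ext. Qed.

Lemma pc_comp1r (M M' : hopfPartialComodule H) (f : pc_hom M M') :
  pc_comp f (pc_id M) = f.
Proof. exact: pc_hom_ext. Qed.

Lemma pc_compA (M N P Q : hopfPartialComodule H)
    (h : pc_hom P Q) (g : pc_hom N P) (f : pc_hom M N) :
  pc_comp h (pc_comp g f) = pc_comp (pc_comp h g) f.
Proof. exact: pc_hom_ext. Qed.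

Definition hopfPartialComodules : category :=
  Category pc_comp1l pc_comp1r pc_compA.

Lemma hp_hom_ext (P P' : hopfPair H) (f g : hp_hom P P') :
  sval f =1 sval g -> f = g.
Proof.
by case: f g => f hf [g hg] /= /linear_ext fg; apply: eq_exist.
Qed.

Lemma hp_comp1l (P P' : hopfPair H) (f : hp_hom P P') :
  hp_comp (hp_id P') f = f.
Proof. exact: hp_hom_ext. Qed.

Lemma hp_comp1r (P P' : hopfPair H) (f : hp_hom P P') :
  hp_comp f (hp_id P) = f.
Proof. exact: hp_hom_ext. Qed.

Lemma hp_compA (P Q R T : hopfPair H)
    (h : hp_hom R T) (g : hp_hom Q R) (f : hp_hom P Q) :
  hp_comp h (hp_comp g f) = hp_comp (hp_comp h g) f.
Proof. exact: hp_hom_ext. Qed.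

Definition hopfPairs : category := Category hp_comp1l hp_comp1r hp_compA.

End Categories.

(* Main.v *)
From HB Require Import structures.
From mathcomp Require Import all_boot all_algebra.
From mathcomp Require Import boolp classical_sets.
Require Import Defs.

(** A partial comodule [M], with structure maps
    [pi : M \ox H -> M * H] (the partial tensor product, written [B] below) and
    [rho : M -> B], is recovered from its partial coinvariants
    [V = {v | rho v = pi (v \ox 1)}] together with the kernel [N] of the action
    map [V \ox H -> M].  Conversely, a pair [(V, N)] gives [M = (V \ox H) / N];
    the map [v \ox h |-> [v \ox h_1] \ox h_2] is a coaction
    [delta : V \ox H -> M \ox H], and [B] is the pushout of [delta] along
    [V \ox H -> M], that is [(M \ox H) / delta N].

    Three facts carry the proof.

    - The axioms GPC1 and GPC2 can be read on elements.  Both sides of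
      coassociativity, [pi \ox H] after [M \ox Delta] ([comul_side]) and
      [rho \ox H] ([coact_side]), have the same left inverse
      [(M * eps) \ox H].  Hence GPC2 forces them to agree on every [z] such that
      [pi z] is in the image of [rho] ([sides_of_gpc2]), and such an agreement
      implies GPC2 ([gpc2_of_sides]).

    - The fundamental theorem of Hopf modules, in the form that
      [m \ox h |-> m h_1 \ox h_2] is an isomorphism of modules from the free
      module on [M] to [M \ox H] with the diagonal action ([transl_bij]); the
      antipode provides the inverse.  Under this isomorphism the two sides above
      become [rho \ox H] and [pi (- \ox 1) \ox H], so that by exactness of
      [- \ox H] the [z] on which they agree are those coming from [V \ox H]
      ([pi_eq_rho]).  In particular [V \ox H -> M] is onto and [ker pi] is the
      image of [N].

    - The map [delta] is the composite of that isomorphism with [q \ox H],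
      where [q v = [v \ox 1]], and [V \ox Delta] maps its kernel onto the
      intersection of [V \ox Delta H] and [N \ox H].  The condition on pairs therefore says that
      [q] is injective ([cap_pair_unit_inj], [cap_of_action]), which is what is
      needed for [V] to be found again as the coinvariants of
      [(V \ox H) / N].

    As [V \ox H] is free on [V], equalities between module maps out of it are
    checked on the elements [v \ox 1] ([free_hom_eq]), where they hold at
    once. *)

Set Implicit Arguments.
Unset Strict Implicit.
Unset Printing Implicit Defensive.

Import GRing.Theory.
Local Open Scope ring_scope.

Local Notation "f \oxid X" := (tmap f (idfun : {linear X -> X}))
  (at level 40, X at level 0).

(** * Subspaces and exactness of the tensor product over a field *)

Section Complement.
Variables (k : fieldType) (U : lmodType k).

Lemma complement_exists (S : submod U) :
  exists C : submod U, (forall u, S u -> C u -> u = 0) /\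
    (forall u, exists s c, [/\ S s, C c & u = s + c]).
Proof.
(* The union of the empty chain does not contain 0: hence P does not ask for 0,
   which is adjoined to the maximal set afterwards. *)
pose P (A : set U) := (forall (a : k) u v, A u -> A v -> A (a *: u + v)) /\
  (forall u, S u -> A u -> u = 0).
have [|A [[A_lin A_cap] A_max]] := @Zorn_bigcup U P.
  move=> F FP F_tot; split=> [a u v [X FX Xu] [Y FY Yv]|u Su [X FX Xu]].
    have [XY|YX] := F_tot _ _ FX FY.
      by exists Y => //; apply: (FP _ FY).1 => //; apply: XY.
    by exists X => //; apply: (FP _ FX).1 => //; apply: YX.
  exact: (FP _ FX).2 Su Xu.
pose A0 u := u = 0 \/ A u.
have A0_lin (a : k) u v : A0 u -> A0 v -> A0 (a *: u + v).
  move=> [->|Au] [->|Av]; rewrite ?scaler0 ?add0r ?addr0.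
  - by left.
  - by right.
  - by right; rewrite -[a](subrK 1) scalerDl scale1r; apply: A_lin.
  - by right; apply: A_lin.
pose C := @Submod k U A0 (or_introl erefl) A0_lin.
exists C; split=> [u Su [//|]|x]; first exact: A_cap.
apply: contrapT => xSC.
pose B u := exists2 c, C c & exists a : k, u = c + a *: x.
apply: (A_max B).
  split=> [u Au|BA].
    by exists u; [right | exists 0; rewrite scale0r addr0].
  apply: xSC; exists 0, x; split; [exact: smem0| |by rewrite add0r].
  by right; apply: BA; exists 0; [left | exists 1; rewrite scale1r add0r].
split=> [a u v [c Cc [b ->]] [d Cd [b' ->]]|u Su [c Cc [a u_eq]]].
  exists (a *: c + d); first exact: smem_lin.
  by exists (a * b + b'); rewrite scalerDr scalerDl scalerA addrACA.
rewrite u_eq in Su *.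
have [a0|a_neq0] := eqVneq a 0.
  move: Su; rewrite a0 scale0r addr0 => Sc; case: Cc => // Ac.
  exact: A_cap.
case: xSC; exists (a^-1 *: (c + a *: x)), (- a^-1 *: c); split.
- exact: smemZ.
- exact: smemZ.
by rewrite scalerDr scalerA mulVf // scale1r scaleNr addrC addKr.
Qed.
End Complement.

(** Send [w] to the unique [u] in a complement of the kernel of [f] such that
    [w - f u] lies in a complement of the image of [f].  Being equational, the
    property survives tensoring, which yields both exactness statements
    below. *)
Lemma generalized_inverse (k : fieldType) (U W : lmodType k)
    (f : {linear U -> W}) :
  exists g : {linear W -> U}, forall u, f (g (f u)) = f u.
Proof.
have kerP (a : k) u v : f u = 0 -> f v = 0 -> f (a *: u + v) = 0.
  by move=> fu fv; rewrite linearP fu fv scaler0 addr0.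
have imP (a : k) u v : (exists x, u = f x) -> (exists x, v = f x) ->
    exists x, a *: u + v = f x.
  by move=> [x ->] [y ->]; exists (a *: x + y); rewrite linearP.
have [C [C_ker C_dec]] := complement_exists (Submod (linear0 f) kerP).
have [D [D_im D_dec]] := complement_exists
  (Submod (ex_intro (fun x => 0 = f x) 0 (esym (linear0 f))) imP).
have gP w : {u | C u /\ D (w - f u)}.
  apply: cid; have [_ [d [[u ->] Dd ->]]] := D_dec w.
  have [s [c [fs Cc ->]]] := C_dec u; exists c; split=> //.
  by rewrite linearD [f s]fs add0r addrC addKr.
have g_uniq w u : C u -> D (w - f u) -> sval (gP w) = u.
  move=> Cu Du; case: (gP w) => v [Cv Dv] /=.
  apply/eqP; rewrite -subr_eq0; apply/eqP/C_ker; last first.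
    by apply: smemD => //; apply: smemN.
  apply: (D_im (f (v - u))); first by exists (v - u).
  have -> : f (v - u) = (w - f u) - (w - f v).
    by rewrite opprB [RHS]addrC subrKA linearB.
  by apply: smemD => //; apply: smemN.
have g_lin : linear (fun w => sval (gP w)).
  move=> a w w'; apply: g_uniq.
    by apply: smem_lin; [case: (svalP (gP w)) | case: (svalP (gP w'))].
  have -> : a *: w + w' - f (a *: sval (gP w) + sval (gP w')) =
      a *: (w - f (sval (gP w))) + (w' - f (sval (gP w'))).
    by rewrite linearP scalerBr opprD addrACA.
  by apply: smem_lin; [case: (svalP (gP w)) | case: (svalP (gP w'))].
exists (mklin g_lin) => u /=.
case: (gP (f u)) => v [_ Dv] /=; apply/eqP; rewrite eq_sym -subr_eq0.
by apply/eqP/D_im => //; exists (u - v); rewrite linearB.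
Qed.

Section Subspace.
Variables (k : fieldType) (U : lmodType k).

Definition smemb (S : submod U) : {pred U} := fun u => `[< S u >].

Lemma smemb_submod_closed (S : submod U) : GRing.submod_closed (smemb S).
Proof.
split=> [|a u v /asboolP Su /asboolP Sv]; apply/asboolP; first exact: smem0.
exact: smem_lin.
Qed.
HB.instance Definition _ (S : submod U) :=
  GRing.isSubmodClosed.Build k U (smemb S) (smemb_submod_closed S).

Record subspace (S : submod U) : predArgType :=
  Subspace { subspace_val : U; _ : subspace_val \in smemb S }.

HB.instance Definition _ S := [isSub for @subspace_val S].
HB.instance Definition _ S := [Choice of subspace S by <:].
HB.instance Definition _ S := [SubChoice_isSubLmodule of subspace S by <:].

Variable S : submod U.

Definition subspace_incl : {linear subspace S -> U} :=
  (val : {linear subspace S -> U}).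

Lemma subspace_incl_inj : injective subspace_incl.
Proof. exact: val_inj. Qed.

Lemma subspace_inclP u : S (subspace_incl u).
Proof. exact/asboolP/(valP u). Qed.

Section Lift.
Variables (W : lmodType k) (f : {linear W -> U}).
Hypothesis fS : forall w, S (f w).

Lemma subspace_lift_subproof w : f w \in smemb S.
Proof. exact/asboolP/fS. Qed.

Lemma subspace_lift_linear :
  linear (fun w => Subspace (subspace_lift_subproof w)).
Proof. by move=> a u v; apply: val_inj; apply: linearP. Qed.

Definition subspace_lift : {linear W -> subspace S} :=
  mklin subspace_lift_linear.
End Lift.
End Subspace.

Section Equalizer.
Variables (k : fieldType) (U W : lmodType k) (f g : {linear U -> W}).

Lemma eq_submod_lin (a : k) u v :
  f u = g u -> f v = g v -> f (a *: u + v) = g (a *: u + v).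
Proof. by move=> fgu fgv; rewrite !linearP fgu fgv. Qed.

Definition eq_submod : submod U :=
  Submod (etrans (linear0 f) (esym (linear0 g))) eq_submod_lin.
End Equalizer.

Lemma bilinBl (k : fieldType) (V W U : lmodType k) (b : V -> W -> U) :
  bilin b -> forall x y w, b (x - y) w = b x w - b y w.
Proof.
by move=> hb x y w; rewrite (bilinDl hb) -scaleN1r (bilinZl hb) scaleN1r.
Qed.

Section FlatTensor.
Variables (k : fieldType) (U W X : lmodType k).

Lemma tmap_inj (f : {linear U -> W}) : injective f -> injective (f \oxid X).
Proof.
move=> f_inj; have [g fgf] := generalized_inverse f.
apply: (can_inj (g := g \oxid X)) => z.
elim/tens_ind: z => [|x y hx hy|u x]; rewrite ?linear0 //.
  by rewrite !linearD hx hy.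
by rewrite !tmapE (f_inj _ _ (fgf u)).
Qed.

(** With [h] a generalized inverse of [d = f - g], the map [id - h d] is a
    projection onto the equalizer of [f] and [g]; tensored with [X], it fixes
    every [z] in the equalizer of [f \ox X] and [g \ox X]. *)
Lemma tmap_equalizer (f g : {linear U -> W}) (z : U \ox X) :
    (f \oxid X) z = (g \oxid X) z ->
  exists w, z = (subspace_incl (eq_submod f g) \oxid X) w.
Proof.
pose d : {linear U -> W} := f \- g.
have [h dhd] := generalized_inverse d.
pose p : {linear U -> U} := idfun \- (h \o d).
have p_mem u : eq_submod f g (p u).
  apply/eqP; rewrite -subr_eq0 -[_ - _]/(d (u - h (d u))).
  by rewrite linearB dhd subrr.
pose pr := subspace_lift p_mem => fgz.
exists ((pr \oxid X) z).
pose F : {linear U \ox X -> U \ox X} :=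
  idfun \- ((h \oxid X) \o ((f \oxid X) \- (g \oxid X))).
have -> : (subspace_incl (eq_submod f g) \oxid X) ((pr \oxid X) z) = F z.
  rewrite tmap_comp; move: z {fgz}; apply: tens_ext => u x.
  rewrite tmapE -[RHS]/(u *t x -
    (h \oxid X) ((f \oxid X) (u *t x) - (g \oxid X) (u *t x))) !tmapE.
  by rewrite -(bilinBl (tpure_bilin W X)) tmapE -(bilinBl (tpure_bilin U X)).
rewrite -[F z]/(z - (h \oxid X) ((f \oxid X) z - (g \oxid X) z)).
by rewrite fgz subrr linear0 subr0.
Qed.
End FlatTensor.

(** * Right modules: images, kernels, quotients and pushouts *)

Section Modules.
Variables (k : fieldType) (A : algType k).

Section ImageKernel.
Variables (M X : rmod A) (f : rhom M X).

Section Image.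
Variable S : rsubmod M.

Definition rimage_set x := exists2 s, S s & x = f s.

Lemma rimage0 : rimage_set 0.
Proof. by exists 0; [exact: smem0 | rewrite linear0]. Qed.

Lemma rimage_lin (a : k) x y :
  rimage_set x -> rimage_set y -> rimage_set (a *: x + y).
Proof.
move=> [s Ss ->] [t St ->]; exists (a *: s + t); last by rewrite linearP.
exact: smem_lin.
Qed.

Lemma rimageJ x a : rimage_set x -> rimage_set (ract x a).
Proof.
by move=> [s Ss ->]; exists (ract s a); [exact: rsubJ | rewrite rfunJ].
Qed.

Definition rimage : rsubmod X :=
  @RSubmod _ _ X (Submod rimage0 rimage_lin) rimageJ.
End Image.

Lemma rker_lin (a : k) x y : f x = 0 -> f y = 0 -> f (a *: x + y) = 0.
Proof. by move=> fx fy; rewrite linearP fx fy scaler0 addr0. Qed.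

Lemma rkerJ x a : f x = 0 -> f (ract x a) = 0.
Proof. by move=> fx; rewrite rfunJ fx (bilin0l (ract_bilin X)). Qed.

Definition rker : rsubmod M :=
  @RSubmod _ _ M (Submod (linear0 f) rker_lin) rkerJ.
End ImageKernel.

Section QuotientLift.
Variables (M X : rmod A) (S : rsubmod M) (f : rhom M X).
Hypothesis fS : forall s, S s -> f s = 0.

Lemma rquot_liftJ x a :
  mklin (qlift_linear fS) (@ract _ _ (rquot S) x a) =
  ract (mklin (qlift_linear fS) x) a.
Proof.
elim/quotW: x => x; rewrite [@ract _ _ (rquot S) _ _]rquot_actE.
by rewrite [LHS](qliftE _ fS) [in RHS](qliftE _ fS : mklin _ _ = _) rfunJ.
Qed.

Definition rquot_lift : rhom (rquot S) X := @RHom _ _ (rquot S) X _ rquot_liftJ.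

Lemma rquot_liftE m : rquot_lift (rqpi S m) = f m.
Proof. exact: (qliftE _ fS). Qed.
End QuotientLift.

Lemma rqpi_eq0 (M : rmod A) (S : rsubmod M) m : rqpi S m = 0 <-> S m.
Proof.
rewrite -(linear0 (rqpi S)); split=> [/qpiP|Sm]; first by rewrite subr0.
by apply/qpiP; rewrite subr0.
Qed.

Lemma rqpi_surj (M : rmod A) (S : rsubmod M) y : exists m, rqpi S m = y.
Proof. by exists (qrep y); apply: qrepK. Qed.

Lemma surj_factor (M N X : rmod A) (p : rhom M N) (f : rhom M X) :
    (forall y, exists z, p z = y) -> (forall z, p z = 0 -> f z = 0) ->
  exists u : rhom N X, forall z, u (p z) = f z.
Proof.
move=> p_surj pf; pose s y := sval (cid (p_surj y)).
have sK y : p (s y) = y by rewrite /s; case: cid.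
have f_eq x y : p x = p y -> f x = f y.
  move=> pxy; apply/eqP; rewrite -subr_eq0 -linearB; apply/eqP/pf.
  by rewrite linearB pxy subrr.
have u_lin : linear (fun y => f (s y)).
  by move=> a x y; rewrite -linearP; apply: f_eq; rewrite linearP !sK.
have uJ y a : mklin u_lin (ract y a) = ract (mklin u_lin y) a.
  by rewrite /= -rfunJ; apply: f_eq; rewrite rfunJ !sK.
by exists (RHom uJ) => z; apply: f_eq; rewrite sK.
Qed.

(** The pushout of a surjection [p : B -> C] along [a : B -> D] is
    [D / a (ker p)]. *)
Section PushoutSurj.
Variables (B C D : rmod A) (p : rhom B C).
Hypothesis p_surj : forall y, exists z, p z = y.

Lemma po_inr_surj (a : rhom B D) x : exists d, po_inr p a d = x.
Proof.
elim/quotW: x => -[c d]; have [z <-] := p_surj c.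
exists (a z + d); rewrite linearD -pushout_comm /= -linearD; congr (qpi _ _).
by congr pair; rewrite /= ?addr0 ?add0r.
Qed.

Lemma po_inr_eq0 (a : rhom B D) d :
  po_inr p a d = 0 -> exists2 z, p z = 0 & d = a z.
Proof.
rewrite -(linear0 (po_inr p a)) => /qpiP [b [b0 bd]].
exists (- b); first by rewrite linearN -b0 /= subrr oppr0.
by rewrite linearN -bd subr0.
Qed.

Lemma po_hom_exists (a b : rhom B D) : (forall z, p z = 0 -> a z = b z) ->
  exists t : rhom (pushout p a) (pushout p b),
    forall d, t (po_inr p a d) = po_inr p b d.
Proof.
move=> ab; have [|u uE] := @surj_factor _ _ _ p (rcomp (po_inr p b) a) p_surj.
  move=> z z0; rewrite -[LHS]/(po_inr p b (a z)) ab // -pushout_comm z0.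
  exact: linear0.
have [t [[_ tr] _]] := @pushout_universal _ _ _ _ _ p a _ u (po_inr p b) uE.
by exists t.
Qed.

Lemma po_iso_exists (a b : rhom B D) : (forall z, p z = 0 -> a z = b z) ->
  exists t : rhom (pushout p a) (pushout p b),
    bijective t /\ forall d, t (po_inr p a d) = po_inr p b d.
Proof.
move=> ab; have [t tE] := po_hom_exists ab.
have [z /ab ->//|t' t'E] := @po_hom_exists b a.
exists t; split=> //; exists t' => x.
- by have [d <-] := po_inr_surj x; rewrite tE t'E.
- by have [d <-] := po_inr_surj x; rewrite t'E tE.
Qed.
End PushoutSurj.
End Modules.

(** * Free modules over a Hopf algebra *)

Section Free.
Variables (k : fieldType) (H : hopfAlgebra k) (V : lmodType k).

Section Ext.
Variables (X : rmod H) (f : {linear V -> X}).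

Definition free_ext_fun : {linear rfree H V -> X} :=
  tlift (bilin_comp f (idfun : {linear H -> H}) (ract_bilin X)).

Lemma free_ext_funE v h : free_ext_fun (v *t h) = ract (f v) h.
Proof. exact: tliftE. Qed.

Lemma free_ext_funJ z h : free_ext_fun (ract z h) = ract (free_ext_fun z) h.
Proof.
elim/tens_ind: z => [|x y hx hy|v g].
- rewrite linear0 (bilin0l (ract_bilin X)).
  by rewrite (bilin0l (ract_bilin (rfree H V))) linear0.
- by rewrite ractD !linearD hx hy ractD.
by rewrite [ract _ _]free_actE !free_ext_funE ractM.
Qed.

Definition free_ext : rhom (rfree H V) X := RHom free_ext_funJ.

Lemma free_ext1 v : free_ext (v *t 1) = f v.
Proof. by rewrite [LHS]free_ext_funE ract1. Qed.
End Ext.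

Lemma pure_ract v h : v *t h = @ract _ _ (rfree H V) (v *t 1) h.
Proof. by rewrite [RHS]free_actE mul1r. Qed.

Lemma free_hom_eq (X : rmod H) (F G : rhom (rfree H V) X) :
  (forall v, F (v *t 1) = G (v *t 1)) -> F =1 G.
Proof.
by move=> FG; apply: tens_ext => v h; rewrite pure_ract !rfunJ FG.
Qed.
End Free.

Section FreeMap.
Variables (k : fieldType) (H : hopfAlgebra k) (V W : lmodType k).
Variable f : {linear V -> W}.

Lemma free_mapJ z h :
  (f \oxid H) (@ract _ _ (rfree H V) z h) =
  @ract _ _ (rfree H W) ((f \oxid H) z) h.
Proof.
elim/tens_ind: z => [|x y hx hy|v g].
- by rewrite linear0 !(bilin0l (ract_bilin (rfree H _))) linear0.
- by rewrite ractD !linearD hx hy ractD.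
by rewrite [ract _ _]free_actE !tmapE [RHS]free_actE.
Qed.

Definition free_map : rhom (rfree H V) (rfree H W) :=
  @RHom _ _ (rfree H V) (rfree H W) (f \oxid H) free_mapJ.

Lemma free_mapE v h : free_map (v *t h) = f v *t h.
Proof. exact: tmapE. Qed.
End FreeMap.

(** * The fundamental isomorphism between the free and the diagonal module *)

Section Translation.
Variables (k : fieldType) (H : hopfAlgebra k).

Definition tunit (V : lmodType k) : {linear V -> V \ox H} :=
  mklin ((tpure_bilin V H).1 1).

Variable M : rmod H.

(** [m \ox h |-> m h_1 \ox h_2] *)
Definition transl : rhom (rfree H M) (rtens M (rH H)) :=
  @free_ext _ H M (rtens M (rH H)) (tunit M).

Lemma transl1 m : transl (m *t 1) = m *t 1.
Proof. exact: (@free_ext1 _ H M (rtens M (rH H))). Qed.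

(** [m \ox h |-> m (s h_1) \ox h_2].  It is [transl] for [s = id], and its
    inverse for [s] the antipode; [s] is kept general because one computation,
    read in both directions, then proves both cancellations. *)
Definition twist (s : {linear H -> H}) : {linear M \ox H -> M \ox H} :=
  tlift (bilin_comp (tunit M) ((s \oxid H) \o Delta H : {linear H -> H \ox H})
    (act2_bilin M (rH H))).

Lemma twistE s m h :
  twist s (m *t h) = @act2 _ _ M (rH H) (m *t 1) ((s \oxid H) (Delta H h)).
Proof. exact: tliftE. Qed.

Lemma translE z : transl z = twist idfun z.
Proof.
elim/tens_ind: z => [|x y hx hy|m h]; first by rewrite !linear0.
- by rewrite !linearD hx hy.
by rewrite twistE tmap_id [LHS]free_ext_funE.
Qed.

(** The composite sends [m \ox h] to [m (s h_1) (t h_2) \ox h_3], and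
    [(s h_1) (t h_2) = eps h]. *)
Lemma twistK (s t : {linear H -> H}) :
    (forall h, mulmap H (tmap s t (Delta H h)) = eps H h *: 1) ->
  cancel (twist s) (twist t).
Proof.
move=> st z; elim/tens_ind: z => [|x y hx hy|m h]; first by rewrite !linear0.
- by rewrite !linearD hx hy.
pose act_m : {linear H -> M} := mklin ((ract_bilin M).2 m).
pose F : {linear H \ox H -> M} := act_m \o (mulmap H \o tmap s t).
pose idH : {linear H -> H} := idfun.
have step u : twist t (@act2 _ _ M (rH H) (m *t 1) (tmap s idH u)) =
    tmap F idH (unassoc (tmap idH (Delta H) u)).
  elim/tens_ind: u => [|x y hx hy|a b].
  - by rewrite !linear0 (bilin0r (act2_bilin M (rH H))) linear0.
  - by rewrite !linearD (bilinDr (act2_bilin M (rH H))) linearD hx hy.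
  rewrite tmapE act2E tmapE [@ract _ _ (rH H) _ _]mul1r twistE.
  elim/tens_ind: (Delta H b) => [|x y hx hy|c d].
  - rewrite (bilin0r (tpure_bilin _ _)) !linear0.
    by rewrite (bilin0r (act2_bilin M (rH H))).
  - rewrite (bilinDr (tpure_bilin _ _)) !linearD.
    by rewrite (bilinDr (act2_bilin M (rH H))) hx hy.
  rewrite tmapE act2E unassocE tmapE [@ract _ _ (rH H) _ _]mul1r -ractM.
  congr (ract m _ *t d).
  by rewrite -[RHS]/(mulmap H (tmap s t (a *t c))) tmapE tliftE.
rewrite twistE step.
have -> : unassoc (tmap idH (Delta H) (Delta H h)) =
    tmap (Delta H) idH (Delta H h).
  exact: esym (canRL assocK (Delta_coassoc h)).
rewrite tmap_comp -[in RHS](Delta_counitl h).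
elim/tens_ind: (Delta H h) => [|x y hx hy|a b].
- by rewrite !linear0 (bilin0r (tpure_bilin _ _)).
- by rewrite !linearD (bilinDr (tpure_bilin _ _)) hx hy.
rewrite tmapE tliftE -[X in X *t _]/(ract m (mulmap H (tmap s t (Delta H a)))).
rewrite st (bilinZr (ract_bilin M)) ract1.
by rewrite (bilinZr (tpure_bilin _ _)) (bilinZl (tpure_bilin _ _)).
Qed.

Lemma transl_bij : bijective transl.
Proof.
exists (twist (antipode H)) => z; rewrite translE.
- exact: (twistK (@antipoder _ H)).
- exact: (twistK (@antipodel _ H)).
Qed.

Lemma transl_inj : injective transl. Proof. exact/bij_inj/transl_bij. Qed.

(** [M \ox eps], which is linear over [H] as [m h_1 (eps (g h_2))] equals
    [(eps g) m h]. *)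
Lemma form_right_epsJ z h :
  form_right M (eps H) (@ract _ _ (rtens M (rH H)) z h) =
  ract (form_right M (eps H) z) h.
Proof.
have b := ract_bilin (rtens M (rH H)).
elim/tens_ind: z => [|x y hx hy|m g].
- by rewrite (bilin0l b) !linear0 (bilin0l (ract_bilin M)).
- by rewrite (bilinDl b) !linearD hx hy ractD.
rewrite [in RHS]tliftE (bilinZl (ract_bilin M)) -[in RHS](Delta_counitr h).
rewrite -[@ract _ _ (rtens M (rH H)) (m *t g) h]/(
  @act2 _ _ M (rH H) (m *t g) (Delta H h)).
elim/tens_ind: (Delta H h) => [|x y hx hy|a c].
- rewrite (bilin0r (act2_bilin M (rH H))) !linear0.
  by rewrite (bilin0r (ract_bilin M)) scaler0.
- rewrite (bilinDr (act2_bilin M (rH H))) !linearD hx hy.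
  by rewrite (bilinDr (ract_bilin M)) scalerDr.
rewrite act2E !tliftE (bilinZr (ract_bilin M)) scalerA; congr (_ *: _).
exact: epsM.
Qed.

Definition rcounit : rhom (rtens M (rH H)) M :=
  @RHom _ _ (rtens M (rH H)) M (form_right M (eps H)) form_right_epsJ.

Lemma rcounitE m h : rcounit (m *t h) = eps H h *: m.
Proof. exact: tliftE. Qed.

Lemma rcounit1 m : rcounit (m *t 1) = m.
Proof. by rewrite rcounitE eps1 scale1r. Qed.
End Translation.

(** * Partial coassociativity on elements *)

Section Coassociativity.
Variables (k : fieldType) (H : hopfAlgebra k) (M B : rmod H).
Variables (p : rhom (rtens M (rH H)) B) (r : rhom M B).

Definition comul_side : rhom (rtens M (rH H)) (rtens B (rH H)) :=
  rcomp (rtmap p (rid (rH H))) (tDelta M).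
Definition coact_side : rhom (rtens M (rH H)) (rtens B (rH H)) :=
  rtmap r (rid (rH H)).

Lemma comul_sideE m h :
  comul_side (m *t h) = (p \oxid H) (unassoc (m *t Delta H h)).
Proof.
rewrite -[LHS]/((p \oxid H) (unassoc
  (tmap (idfun : {linear M -> M}) (Delta H) (m *t h)))).
by rewrite tmapE.
Qed.

Lemma comul_side1 m : comul_side (m *t 1) = p (m *t 1) *t 1.
Proof. by rewrite comul_sideE Delta1 unassocE tmapE. Qed.

Lemma coact_sideE m h : coact_side (m *t h) = r m *t h.
Proof. exact: tmapE. Qed.

Lemma transl_comul_side x :
  transl B (free_map H (p \o tunit H M) x) = comul_side (transl M x).
Proof.
apply: (@free_hom_eq _ _ _ _
  (rcomp (transl B) (free_map H (p \o tunit H M)))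
  (rcomp comul_side (transl M))) => v.
rewrite -[LHS]/(transl B (free_map _ _ _)) free_mapE transl1.
by rewrite -[RHS]/(comul_side (transl M _)) transl1 comul_side1.
Qed.

Lemma transl_coact_side x :
  transl B (free_map H r x) = coact_side (transl M x).
Proof.
apply: (@free_hom_eq _ _ _ _
  (rcomp (transl B) (free_map H r)) (rcomp coact_side (transl M))) => v.
rewrite -[LHS]/(transl B (free_map _ _ _)) free_mapE transl1.
by rewrite -[RHS]/(coact_side (transl M _)) transl1 coact_sideE.
Qed.

(** When [p] is onto, the two pushouts in GPC2 are the quotients of [B \ox H] by
    the images of [ker p] under the two sides. *)
Lemma gpc2_of_sides : (forall y, exists z, p z = y) ->
    (forall z, p z = 0 -> comul_side z = coact_side z) ->
    (forall m, exists2 z, p z = r m & comul_side z = coact_side z) ->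
  GPC2 p r.
Proof.
move=> p_surj sides_ker sides_lift.
have [t [t_bij tE]] := po_iso_exists p_surj sides_ker.
exists t; split=> // m; have [z <- z_eq] := sides_lift m.
by rewrite [X in t X]pushout_comm tE z_eq [RHS]pushout_comm.
Qed.

Section Counit.
Variable e : rhom B M.
Hypothesis e_r : forall m, e (r m) = m.
Hypothesis e_p : forall z, e (p z) = form_right M (eps H) z.

Lemma counit_coact_side z : rtmap e (rid (rH H)) (coact_side z) = z.
Proof.
elim/tens_ind: z => [|x y hx hy|m h]; first by rewrite !linear0.
- by rewrite !linearD hx hy.
by rewrite coact_sideE [LHS]tmapE e_r.
Qed.

Lemma counit_comul_side z : rtmap e (rid (rH H)) (comul_side z) = z.
Proof.
have hM := tpure_bilin M H; have hMH := tpure_bilin M (H \ox H).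
elim/tens_ind: z => [|x y hx hy|m h]; first by rewrite !linear0.
- by rewrite !linearD hx hy.
rewrite comul_sideE -[in RHS](Delta_counitl h).
elim/tens_ind: (Delta H h) => [|x y hx hy|a b].
- by rewrite (bilin0r hMH) !linear0 (bilin0r hM).
- by rewrite (bilinDr hMH) !linearD (bilinDr hM) hx hy.
rewrite unassocE tmapE [LHS]tmapE e_p !tliftE.
by rewrite (bilinZr hM) (bilinZl hM).
Qed.

(** GPC2 equates the classes of the two sides of [z], hence gives [x] in [ker p]
    with [comul_side z - coact_side z = coact_side x]; applying the common left
    inverse [e \ox H] of both sides, [x = z - z = 0]. *)
Lemma sides_of_gpc2 z m :
  GPC2 p r -> p z = r m -> comul_side z = coact_side z.
Proof.
move=> [t [t_bij tE t_r]] zm.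
have /po_inr_eq0 [x x0] :
    po_inr p coact_side (comul_side z - coact_side z) = 0.
  rewrite linearB; apply/eqP; rewrite subr_eq0; apply/eqP.
  rewrite -[LHS]tE -[X in t X]pushout_comm -[RHS]pushout_comm zm.
  exact: t_r.
move=> z_eq; suff x_eq0 : x = 0.
  by apply/eqP; rewrite -subr_eq0 z_eq x_eq0 linear0.
rewrite -[x]counit_coact_side -z_eq linearB counit_comul_side.
by rewrite counit_coact_side subrr.
Qed.
End Counit.
End Coassociativity.

(** * The partial comodule of a pair *)

Section PairToComodule.
Variables (k : fieldType) (H : hopfAlgebra k) (V : lmodType k).
Variable N : rsubmod (rfree H V).

Definition pair_car : rmod H := rquot N.
Definition pair_unit : {linear V -> pair_car} := rqpi N \o tunit H V.
Definition pair_coaction : rhom (rfree H V) (rtens pair_car (rH H)) :=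
  @free_ext _ H V (rtens pair_car (rH H)) (tunit H pair_car \o pair_unit).
Definition pair_bullet : rmod H := rquot (rimage pair_coaction N).
Definition pair_pi : rhom (rtens pair_car (rH H)) pair_bullet :=
  rqpi (rimage pair_coaction N).

Lemma pair_unitE v : pair_unit v = rqpi N (v *t 1). Proof. by []. Qed.

Lemma pair_coaction1 v : pair_coaction (v *t 1) = pair_unit v *t 1.
Proof. exact: free_ext1. Qed.

Lemma pair_rho_subproof n : N n -> rcomp pair_pi pair_coaction n = 0.
Proof. by move=> Nn; apply/rqpi_eq0; exists n. Qed.
Definition pair_rho : rhom pair_car pair_bullet :=
  rquot_lift pair_rho_subproof.

Lemma pair_rhoE y : pair_rho (rqpi N y) = pair_pi (pair_coaction y).
Proof. exact: rquot_liftE. Qed.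

Lemma pair_pi_surj y : exists z, pair_pi z = y.
Proof. exact: rqpi_surj. Qed.

Lemma rcounit_pair_coaction y : rcounit pair_car (pair_coaction y) = rqpi N y.
Proof.
apply: (@free_hom_eq _ _ _ _ (rcomp (rcounit pair_car) pair_coaction)) => v.
by rewrite -[LHS]/(rcounit pair_car (pair_coaction _)) pair_coaction1 rcounit1.
Qed.

Lemma pair_gpc1 : GPC1 pair_pi pair_rho.
Proof.
have e_proof z : rimage pair_coaction N z -> rcounit pair_car z = 0.
  by move=> [n Nn ->]; rewrite rcounit_pair_coaction; apply/rqpi_eq0.
exists (rquot_lift e_proof); split=> [m|z]; last exact: rquot_liftE.
have [y <-] := rqpi_surj m.
by rewrite pair_rhoE [LHS]rquot_liftE rcounit_pair_coaction.
Qed.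

Lemma pair_sides y : comul_side pair_pi (pair_coaction y) =
  coact_side pair_rho (pair_coaction y).
Proof.
apply: (@free_hom_eq _ _ _ _ (rcomp (comul_side pair_pi) pair_coaction)
  (rcomp (coact_side pair_rho) pair_coaction)) => v.
rewrite -[LHS]/(comul_side pair_pi (pair_coaction _)).
rewrite -[RHS]/(coact_side pair_rho (pair_coaction _)).
rewrite pair_coaction1 comul_side1 coact_sideE.
by rewrite pair_unitE pair_rhoE pair_coaction1.
Qed.

Lemma pair_gpc2 : GPC2 pair_pi pair_rho.
Proof.
apply: gpc2_of_sides => [y|z|m]; first exact: pair_pi_surj.
  by move=> /rqpi_eq0 [n _ ->]; apply: pair_sides.
have [y <-] := rqpi_surj m.
by exists (pair_coaction y); [rewrite pair_rhoE | exact: pair_sides].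
Qed.

Definition pair_comodule : hopfPartialComodule H :=
  HopfPartialComodule pair_pi_surj pair_gpc1 pair_gpc2.

Lemma pair_coaction_transl y :
  pair_coaction y = transl pair_car (free_map H pair_unit y).
Proof.
apply: (@free_hom_eq _ _ _ _ pair_coaction
  (rcomp (transl pair_car) (free_map H pair_unit))) => v.
rewrite -[RHS]/(transl pair_car (free_map _ _ _)) free_mapE pair_coaction1.
by rewrite transl1.
Qed.

(** If [v \ox 1] is in [N], then [v \ox 1 \ox 1] is in both subspaces. *)
Lemma cap_pair_unit_inj :
  (forall z, V_DeltaH z -> N_H N z -> z = 0) -> injective pair_unit.
Proof.
move=> cap v w /eqP; rewrite -subr_eq0 -linearB => /eqP /rqpi_eq0 Nvw.
apply/eqP; rewrite -subr_eq0; apply/eqP; set u := v - w in Nvw *.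
have /(congr1 (form_right _ (eps H))) :
    ((u *t 1) *t 1 : (V \ox H) \ox H) = 0.
  apply: cap.
  - exists [:: (u, Delta H 1)] => [p|].
      by rewrite inE => /eqP ->; split=> //; exists 1.
    by rewrite big_seq1 assocE Delta1.
  - exists [:: (u *t 1, 1)] => [p|]; first by rewrite inE => /eqP ->.
    by rewrite big_seq1.
rewrite linear0 tliftE eps1 scale1r => /(congr1 (form_right _ (eps H))).
by rewrite linear0 tliftE eps1 scale1r.
Qed.
End PairToComodule.

Section PairToComoduleMap.
Variables (k : fieldType) (H : hopfAlgebra k) (V V' : lmodType k).
Variables (N : rsubmod (rfree H V)) (N' : rsubmod (rfree H V')).
Variable f : {linear V -> V'}.
Hypothesis fN : forall z, N z -> N' (free_map H f z).

Lemma pair_map_subproof n : N n -> rcomp (rqpi N') (free_map H f) n = 0.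
Proof. by move=> Nn; apply/rqpi_eq0/fN. Qed.
Definition pair_map : rhom (pair_car N) (pair_car N') :=
  rquot_lift pair_map_subproof.

Lemma pair_mapE y : pair_map (rqpi N y) = rqpi N' (free_map H f y).
Proof. exact: rquot_liftE. Qed.

Lemma pair_map_coaction y :
  rtmap pair_map (rid (rH H)) (pair_coaction N y) =
  pair_coaction N' (free_map H f y).
Proof.
apply: (@free_hom_eq _ _ _ _
  (rcomp (rtmap pair_map (rid (rH H))) (pair_coaction N))
  (rcomp (pair_coaction N') (free_map H f))) => v.
rewrite -[LHS]/(rtmap pair_map (rid (rH H)) (pair_coaction N _)).
rewrite -[RHS]/(pair_coaction N' (free_map H f _)).
by rewrite free_mapE !pair_coaction1 [LHS]tmapE !pair_unitE pair_mapE free_mapE.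
Qed.

Lemma pair_map_is_pc_morphism :
  @is_pc_morphism _ _ (pair_comodule N) (pair_comodule N') pair_map.
Proof.
have fH_proof z : rimage (pair_coaction N) N z ->
    rcomp (pair_pi N') (rtmap pair_map (rid (rH H))) z = 0.
  move=> [n Nn ->]; apply/rqpi_eq0; rewrite pair_map_coaction.
  by exists (free_map H f n) => //; apply: fN.
exists (rquot_lift fH_proof); split=> [m|z]; last exact: rquot_liftE.
have [y <-] := rqpi_surj m.
rewrite [pc_rho _ _]pair_rhoE [LHS]rquot_liftE pair_mapE [RHS]pair_rhoE.
by rewrite -[LHS]/(pair_pi N' (rtmap pair_map _ _)) pair_map_coaction.
Qed.
End PairToComoduleMap.

(** * The pair of a partial comodule *)

(** An element of the intersection is [(V \ox Delta) y] for some [y], and is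
    killed by [a \ox H], where [a : V \ox H -> M] is the action map.  But
    [a \ox H] after [V \ox Delta] is [transl] after [j \ox H], a composite of
    injective maps; hence [y = 0]. *)
Lemma cap_of_action (k : fieldType) (H : hopfAlgebra k) (V : lmodType k)
    (N : rsubmod (rfree H V)) (M : rmod H) (j : {linear V -> M}) :
    injective j -> (forall y, N y -> free_ext j y = 0) ->
  forall z, V_DeltaH z -> N_H N z -> z = 0.
Proof.
move=> j_inj Nj z [s s_in sz] [t t_in tz].
pose idH : {linear H -> H} := idfun; pose idV : {linear V -> V} := idfun.
have [y yz] : exists y : V \ox H, z = unassoc (tmap idV (Delta H) y).
  suff [y yE] : exists y, \sum_(p <- s) p.1 *t p.2 = tmap idV (Delta H) y.
    by exists y; apply: (canRL assocK); rewrite -yE.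
  elim: s s_in {sz} => [_|p s IHs s_in].
    by exists 0; rewrite big_nil linear0.
  have [|y yE] := IHs; first by move=> q qs; apply: s_in; rewrite inE qs orbT.
  have [_ [h ph]] := s_in p (mem_head _ _).
  by exists (p.1 *t h + y); rewrite big_cons yE linearD tmapE ph.
have act_comul x : tmap (free_ext j) idH (unassoc (tmap idV (Delta H) x)) =
    transl M (free_map H j x).
  elim/tens_ind: x => [|x x' hx hx'|v h]; first by rewrite !linear0.
  - by rewrite !linearD hx hx'.
  rewrite tmapE free_mapE translE twistE tmap_id.
  elim/tens_ind: (Delta H h) => [|x x' hx hx'|a b].
  - rewrite (bilin0r (tpure_bilin _ _)) !linear0.
    by rewrite (bilin0r (act2_bilin M (rH H))).
  - rewrite (bilinDr (tpure_bilin _ _)) !linearD hx hx'.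
    by rewrite (bilinDr (act2_bilin M (rH H))).
  rewrite unassocE tmapE act2E [free_ext _ _]free_ext_funE.
  by rewrite [@ract _ _ (rH H) _ _]mul1r.
have act_z0 : tmap (free_ext j) idH z = 0.
  rewrite tz linear_sum big1_seq // => p /andP[_ /t_in [Np _]].
  by rewrite tmapE Nj // (bilin0l (tpure_bilin _ _)).
suff y0 : y = 0 by rewrite yz y0 !linear0.
apply: (tmap_inj (X := H) j_inj); rewrite linear0.
by apply: transl_inj; rewrite -[LHS]act_comul -yz act_z0 linear0.
Qed.

Section ComoduleToPair.
Variables (k : fieldType) (H : hopfAlgebra k) (M : hopfPartialComodule H).

Definition coinv_submod : submod M :=
  eq_submod (pc_rho M) (pc_pi M \o tunit H M).
Definition coinv : lmodType k := subspace coinv_submod.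
Definition coinv_incl : {linear coinv -> M} := subspace_incl coinv_submod.
Definition coinv_act : rhom (rfree H coinv) M := free_ext coinv_incl.

Lemma coinvP v : pc_rho M (coinv_incl v) = pc_pi M (coinv_incl v *t 1).
Proof. exact: (subspace_inclP v). Qed.

Lemma coinv_cap z : V_DeltaH z -> N_H (rker coinv_act) z -> z = 0.
Proof. by move: z; apply: (cap_of_action (j := coinv_incl) val_inj). Qed.

Definition coinv_pair : hopfPair H := HopfPair coinv_cap.

(** The globalization [V \ox H] of [M], embedded in [M \ox H]. *)
Definition coinv_global : rhom (rfree H coinv) (rtens M (rH H)) :=
  rcomp (transl M) (free_map H coinv_incl).

Lemma coinv_global1 v : coinv_global (v *t 1) = coinv_incl v *t 1.
Proof.
by rewrite -[LHS]/(transl M (free_map _ _ _)) free_mapE transl1.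
Qed.

Lemma rcounit_coinv_global w : rcounit M (coinv_global w) = coinv_act w.
Proof.
apply: (@free_hom_eq _ _ _ _ (rcomp (rcounit M) coinv_global)) => v.
rewrite -[LHS]/(rcounit M (coinv_global _)) coinv_global1 rcounit1.
by rewrite [RHS]free_ext1.
Qed.

Lemma pi_coinv_global w : pc_pi M (coinv_global w) = pc_rho M (coinv_act w).
Proof.
apply: (@free_hom_eq _ _ _ _ (rcomp (pc_pi M) coinv_global)
  (rcomp (pc_rho M) coinv_act)) => v.
rewrite -[LHS]/(pc_pi M (coinv_global _)) -[RHS]/(pc_rho M (coinv_act _)).
by rewrite coinv_global1 [coinv_act _]free_ext1 coinvP.
Qed.

(** The two sides of coassociativity agree on [z]; transported along [transl],
    this says that [z] comes from the equalizer of [rho \ox H] and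
    [pi (- \ox 1) \ox H], which is [V \ox H]. *)
Lemma pi_eq_rho z m : pc_pi M z = pc_rho M m ->
  exists2 w, z = coinv_global w & coinv_act w = m.
Proof.
move=> zm; have [e [e_rho e_pi]] := pc_gpc1 M.
have sides := sides_of_gpc2 e_rho e_pi (pc_gpc2 M) zm.
have [g _ gK] := transl_bij M.
suff [w w_eq] : exists w, g z = free_map H coinv_incl w.
  exists w; first by rewrite -[z]gK w_eq.
  rewrite -rcounit_coinv_global -[coinv_global w]/(transl M _) -w_eq gK.
  by rewrite -[LHS]e_pi zm e_rho.
apply: tmap_equalizer; apply: (@transl_inj _ _ (pc_bullet M)).
rewrite -[in RHS](gK z) -[in LHS](gK z) in sides.
by rewrite [LHS]transl_coact_side [RHS]transl_comul_side.
Qed.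

Lemma coinv_act_surj m : exists w, coinv_act w = m.
Proof.
have [z zm] := pc_pi_surj (pc_rho M m).
by have [w _ wm] := pi_eq_rho zm; exists w.
Qed.
End ComoduleToPair.

Section ComoduleToPairMap.
Variables (k : fieldType) (H : hopfAlgebra k) (M M' : hopfPartialComodule H).
Variable f : pc_hom M M'.

Lemma coinv_map_subproof v : coinv_submod M' ((sval f \o coinv_incl M) v).
Proof.
have [fH [f_rho f_pi]] := svalP f.
rewrite -[coinv_submod _ _]/(pc_rho M' (sval f _) = pc_pi M' (sval f _ *t 1)).
by rewrite -f_rho coinvP f_pi [rtmap _ _ _]tmapE.
Qed.
Definition coinv_map : {linear coinv M -> coinv M'} :=
  subspace_lift coinv_map_subproof.

Lemma coinv_act_map z :
  coinv_act M' (free_map H coinv_map z) = sval f (coinv_act M z).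
Proof.
apply: (@free_hom_eq _ _ _ _ (rcomp (coinv_act M') (free_map H coinv_map))
  (rcomp (sval f) (coinv_act M))) => v.
rewrite -[LHS]/(coinv_act M' (free_map _ _ _)).
rewrite -[RHS]/(sval f (coinv_act M _)).
by rewrite free_mapE ![coinv_act _ _]free_ext1.
Qed.

Lemma coinv_map_is_hp_morphism :
  @is_hp_morphism _ _ (coinv_pair M) (coinv_pair M') coinv_map.
Proof.
move=> z z0.
rewrite -[hp_N _ _]/(coinv_act M' (free_map H coinv_map z) = 0).
by rewrite coinv_act_map [coinv_act _ _]z0 linear0.
Qed.
End ComoduleToPairMap.

(** * The equivalence *)

Lemma nat_isomorphic_sym (C D : category) (F G : functor C D) :
  nat_isomorphic F G -> nat_isomorphic G F.
Proof.
move=> [a [a_iso a_nat]].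
exists (fun X => sval (cid (a_iso X))); split=> [X|X Y f].
  by case: cid => b [ba ab]; exists (a X).
case: cid => b [ba ab]; case: cid => b' [ba' ab'] /=.
by rewrite -[LHS]ccomp1r -ab' ccompA -(ccompA b) -a_nat !ccompA ba ccomp1l.
Qed.

Section Equivalence.
Variables (k : fieldType) (H : hopfAlgebra k).

Definition pair_of_pc_map (M M' : hopfPartialComodules H) (f : hom M M') :
    @hom (hopfPairs H) (coinv_pair M) (coinv_pair M') :=
  exist _ _ (coinv_map_is_hp_morphism f).

Lemma pair_of_pc_id (M : hopfPartialComodules H) :
  pair_of_pc_map (cidm M) = cidm _.
Proof. by apply: hp_hom_ext => v; apply: subspace_incl_inj. Qed.

Lemma pair_of_pc_comp (M M' M'' : hopfPartialComodules H)
    (g : hom M' M'') (f : hom M M') :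
  pair_of_pc_map (ccomp g f) = ccomp (pair_of_pc_map g) (pair_of_pc_map f).
Proof. by apply: hp_hom_ext => v; apply: subspace_incl_inj. Qed.

Definition pair_of_pc : functor (hopfPartialComodules H) (hopfPairs H) :=
  @Functor (hopfPartialComodules H) (hopfPairs H) _
    pair_of_pc_map pair_of_pc_id pair_of_pc_comp.

Definition pc_of_pair_obj (P : hopfPairs H) : hopfPartialComodules H :=
  pair_comodule (hp_N P).

Definition pc_of_pair_map (P P' : hopfPairs H) (f : hom P P') :
    hom (pc_of_pair_obj P) (pc_of_pair_obj P') :=
  exist _ _ (pair_map_is_pc_morphism (svalP f)).

Lemma pc_of_pair_mapE (P P' : hopfPairs H) (f : hom P P') y :
  sval (pc_of_pair_map f) (rqpi (hp_N P) y) =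
  rqpi (hp_N P') (free_map H (sval f) y).
Proof. exact: pair_mapE. Qed.

Lemma pc_of_pair_id (P : hopfPairs H) : pc_of_pair_map (cidm P) = cidm _.
Proof.
apply: pc_hom_ext => m; have [y <-] := rqpi_surj m.
by rewrite [LHS]pair_mapE [free_map _ _ _]tmap_id.
Qed.

Lemma pc_of_pair_comp (P P' P'' : hopfPairs H)
    (g : hom P' P'') (f : hom P P') :
  pc_of_pair_map (ccomp g f) = ccomp (pc_of_pair_map g) (pc_of_pair_map f).
Proof.
apply: pc_hom_ext => m; have [y <-] := rqpi_surj m.
rewrite pc_of_pair_mapE.
rewrite -[RHS]/(sval (pc_of_pair_map g) (sval (pc_of_pair_map f) (rqpi _ y))).
by rewrite !pc_of_pair_mapE; congr (rqpi _ _); rewrite [RHS]tmap_comp.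
Qed.

Definition pc_of_pair : functor (hopfPairs H) (hopfPartialComodules H) :=
  @Functor (hopfPairs H) (hopfPartialComodules H) _
    pc_of_pair_map pc_of_pair_id pc_of_pair_comp.

Section ComoduleIso.
Variable M : hopfPartialComodule H.
Let N := rker (coinv_act M).

Definition counit_map : rhom (pair_car N) M :=
  @rquot_lift _ _ _ _ N (coinv_act M) (fun _ => id).

Lemma counit_mapE w : counit_map (rqpi N w) = coinv_act M w.
Proof. exact: rquot_liftE. Qed.

Lemma counit_map_coaction w :
  rtmap counit_map (rid (rH H)) (pair_coaction N w) = coinv_global M w.
Proof.
apply: (@free_hom_eq _ _ _ _
  (rcomp (rtmap counit_map (rid _)) (pair_coaction N)) (coinv_global M)) => v.
rewrite -[LHS]/(rtmap _ _ (pair_coaction N _)) pair_coaction1 coinv_global1.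
by rewrite [LHS]tmapE pair_unitE counit_mapE [coinv_act _ _]free_ext1.
Qed.

Lemma counit_map_is_pc_morphism :
  @is_pc_morphism _ _ (pair_comodule N) M counit_map.
Proof.
have cH_proof z : rimage (pair_coaction N) N z ->
    rcomp (pc_pi M) (rtmap counit_map (rid (rH H))) z = 0.
  move=> [w Nw ->]; rewrite -[LHS]/(pc_pi M (rtmap _ _ _)).
  by rewrite counit_map_coaction pi_coinv_global [coinv_act _ _]Nw linear0.
exists (rquot_lift cH_proof); split=> [m|z]; last exact: rquot_liftE.
have [w <-] := rqpi_surj m.
rewrite [pc_rho (pair_comodule N) _]pair_rhoE [LHS]rquot_liftE counit_mapE.
rewrite -[LHS]/(pc_pi M (rtmap _ _ _)).
by rewrite counit_map_coaction pi_coinv_global.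
Qed.

Definition counit_hom : pc_hom (pair_comodule N) M :=
  exist _ _ counit_map_is_pc_morphism.

(** The inverse [g : M -> (V \ox H) / N] extends to the partial tensor products
    because [ker pi] is the image of [N] in [M \ox H] ([pi_eq_rho] at 0). *)
Lemma counit_hom_iso : @is_iso (hopfPartialComodules H) _ _ counit_hom.
Proof.
have [w w0|g gE] :=
    @surj_factor _ _ _ _ _ _ (rqpi N) (coinv_act_surj (M := M)).
  exact/rqpi_eq0.
have g_global w :
    rtmap g (rid (rH H)) (coinv_global M w) = pair_coaction N w.
  apply: (@free_hom_eq _ _ _ _ (rcomp (rtmap g (rid _)) (coinv_global M))
    (pair_coaction N)) => v.
  rewrite -[LHS]/(rtmap _ _ (coinv_global M _)) pair_coaction1 coinv_global1.
  by rewrite [LHS]tmapE; congr (_ *t 1); rewrite -[coinv_incl M v]free_ext1 gE.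
have [z z0|gH gHE] := @surj_factor _ _ _ _ _ _
    (rcomp (pair_pi N) (rtmap g (rid _))) (pc_pi_surj (h := M)).
  rewrite -(linear0 (pc_rho M)) in z0; have [w -> w0] := pi_eq_rho z0.
  rewrite -[LHS]/(pair_pi N (rtmap _ _ _)) g_global; apply/rqpi_eq0.
  by exists w.
have g_mor : @is_pc_morphism _ _ M (pair_comodule N) g.
  exists gH; split=> // m; have [w <-] := coinv_act_surj m.
  rewrite -pi_coinv_global gHE -[LHS]/(pair_pi N (rtmap _ _ _)) g_global gE.
  by rewrite -pair_rhoE.
exists (exist _ g g_mor); split; apply: pc_hom_ext => m.
- have [w <-] := rqpi_surj m.
  by rewrite -[LHS]/(g (counit_map _)) counit_mapE gE.
- have [w <-] := coinv_act_surj m.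
  by rewrite -[LHS]/(counit_map (g _)) gE counit_mapE.
Qed.
End ComoduleIso.

Lemma counit_natural (M M' : hopfPartialComodules H) (f : hom M M') :
  ccomp (counit_hom M' : hom (pc_of_pair (pair_of_pc M')) M')
    (fmap pc_of_pair (fmap pair_of_pc f)) =
  ccomp f (counit_hom M : hom (pc_of_pair (pair_of_pc M)) M).
Proof.
apply: pc_hom_ext => m; have [w <-] := rqpi_surj m.
rewrite -[LHS]/(counit_map M' (pair_map _ _)) pair_mapE counit_mapE.
by rewrite -[RHS]/(sval f (counit_map M _)) counit_mapE coinv_act_map.
Qed.

Section PairIso.
Variable P : hopfPair H.
Let M := pair_comodule (hp_N P).

Lemma pair_unit_coinv v : coinv_submod M (pair_unit (hp_N P) v).
Proof.
by rewrite -[coinv_submod _ _]/(pair_rho _ (rqpi _ _) = pair_pi _ (_ *t 1))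
  pair_rhoE pair_coaction1.
Qed.

Definition unit_map : {linear hp_V P -> coinv M} :=
  subspace_lift pair_unit_coinv.

Lemma coinv_act_unit z : coinv_act M (free_map H unit_map z) = rqpi (hp_N P) z.
Proof.
apply: (@free_hom_eq _ _ _ _ (rcomp (coinv_act M) (free_map H unit_map))
  (rqpi (hp_N P))) => v.
by rewrite -[LHS]/(coinv_act M (free_map _ _ _)) free_mapE [LHS]free_ext1.
Qed.

Lemma unit_map_is_hp_morphism : @is_hp_morphism _ _ P (coinv_pair M) unit_map.
Proof.
move=> z Nz; rewrite -[hp_N _ _]/(coinv_act M (free_map H unit_map z) = 0).
by rewrite coinv_act_unit; apply/rqpi_eq0.
Qed.

Definition unit_hom : hp_hom P (coinv_pair M) :=
  exist _ _ unit_map_is_hp_morphism.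

Lemma unit_map_inj : injective unit_map.
Proof.
move=> v w /(congr1 (coinv_incl M)).
exact: (cap_pair_unit_inj (@hp_cap _ _ P)).
Qed.

(** Write [q] for [pair_unit] and [delta] for [pair_coaction].  For a
    coinvariant [m = [y]], the elements [m \ox 1] and [delta y] have the
    same image under [pi], hence differ by [delta n] with [n] in [N].  So
    [transl (m \ox 1) = m \ox 1 = delta x] with [x = y - n], and
    [delta = transl (q \ox H)]; cancelling [transl] gives
    [m \ox 1 = (q \ox H) x], whence [m] is in the image of [q] on applying the
    counit. *)
Lemma unit_map_surj m : exists v, unit_map v = m.
Proof.
have [y ym] := rqpi_surj (coinv_incl M m).
have := coinvP m; rewrite -[in LHS]ym [LHS]pair_rhoE => /eqP.
rewrite -subr_eq0 -linearB => /eqP/rqpi_eq0 [n _ yn].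
have {yn} : pair_coaction (hp_N P) (y - n) = coinv_incl M m *t 1.
  by rewrite linearB -yn subKr.
set x := y - n; rewrite pair_coaction_transl -[RHS](@transl1 _ H M).
move/(@transl_inj _ _ M) => xm.
exists (form_right _ (eps H) x); apply: subspace_incl_inj.
rewrite -[LHS]/(pair_unit (hp_N P) _) -[RHS](rcounit1 (M := M)) -xm.
elim/tens_ind: (x) => [|z z' hz hz'|v h]; first by rewrite !linear0.
- by rewrite !linearD hz hz'.
by rewrite tliftE linearZ free_mapE rcounitE.
Qed.

Lemma unit_hom_iso : @is_iso (hopfPairs H) _ _ unit_hom.
Proof.
have [g ugu] := generalized_inverse unit_map.
have gu v : g (unit_map v) = v by apply/unit_map_inj/ugu.
have ug m : unit_map (g m) = m by have [v <-] := unit_map_surj m; rewrite gu.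
have g_mor : @is_hp_morphism _ _ (coinv_pair M) P g.
  move=> z Nz; apply/rqpi_eq0.
  rewrite -coinv_act_unit -[RHS]Nz; congr (coinv_act M _).
  rewrite [LHS]tmap_comp -[RHS]tmap_id; move: (z).
  by apply: tens_ext => m h; rewrite !tmapE; congr (_ *t _); apply: ug.
exists (exist _ g g_mor); split; apply: hp_hom_ext => v.
- exact: gu.
- exact: ug.
Qed.
End PairIso.

Lemma unit_natural (P P' : hopfPairs H) (f : hom P P') :
  ccomp (unit_hom P' : hom P' (pair_of_pc (pc_of_pair P'))) f =
  ccomp (fmap pair_of_pc (fmap pc_of_pair f))
    (unit_hom P : hom P (pair_of_pc (pc_of_pair P))).
Proof.
apply: hp_hom_ext => v; apply: subspace_incl_inj.
rewrite -[LHS]/(pair_unit (hp_N P') (sval f v)).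
rewrite -[RHS]/(sval (pc_of_pair_map f) (pair_unit (hp_N P) v)).
by rewrite !pair_unitE pc_of_pair_mapE free_mapE.
Qed.
End Equivalence.

Theorem theorem4p6 (k : fieldType) (H : hopfAlgebra k) :
  cat_equivalent (hopfPartialComodules H) (hopfPairs H).
Proof.
exists (pair_of_pc H), (pc_of_pair H); split.
  exists (fun M => counit_hom M); split=> [M|M M' f].
  - exact: counit_hom_iso.
  - exact: counit_natural.
apply: nat_isomorphic_sym.
exists (fun P => unit_hom P); split=> [P|P P' f].
- exact: unit_hom_iso.
- exact: unit_natural.
Qed.
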